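(* Let $R$ be the Reuleaux triangle of width $1$, whose skeleton $\mathcal S(R)$ is the equilateral triangle of side length $1$. For every Reuleaux polygon $P$ of width $1$, the area of its skeleton satisfies \[ A(\mathcal S(P))\ \ge\ A(\mathcal S(R)), \] i.e. the area of $\mathcal S(P)$ is minimal when $P$ is a Reuleaux triangle and $\mathcal S(P)$ is an equilateral triangle. Moreover, the area of $\mathcal S(P)$ is bounded above by $\pi/4$ (the area of a disk of radius $1/2$), and this extremal value is not attained: $A(\mathcal S(P))<\pi/4$ for every Reuleaux polygon $P$ of width $1$.
   Context: $A(\cdot)$ denotes area in the plane. A planar convex body has constant width $1$ if the distance between any two distinct parallel supporting lines is $1$. A Reuleaux polygon (of width $1$) is a planar convex body $P$ of constant width $1$ whose boundary is a union of finitely many (an odd number $n=2k+1\ge 3$) arcs of circles of radius $1$, each arc being centered at a vertex of $P$; the vertices of $P$ are the common endpoints of consecutive arcs. The skeleton $\mathcal S(P)$ is the convex hull of the vertices of $P$. The Reuleaux triangle $R$ is the intersection of the three closed disks of radius $1$ centered at the vertices of an equilateral triangle of side length $1$. *)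

(* Defs.v *)
(* MathComp-Analysis: the plane is R * R for R : realType. *)
From mathcomp Require Import all_boot all_order all_algebra.
From mathcomp Require Import all_classical all_reals all_analysis.

Set Implicit Arguments.
Unset Strict Implicit.
Unset Printing Implicit Defensive.

Import Order.TTheory GRing.Theory Num.Theory.
Import numFieldNormedType.Exports.

Local Open Scope classical_set_scope.
Local Open Scope ring_scope.

Definition dotp (R : realType) (u x : R * R) : R := u.1 * x.1 + u.2 * x.2.

(* The library norm on R * R is the max norm, hence an explicit Euclidean
   distance. The product topology is the same for both. *)
Definition eucl_dist (R : realType) (x y : R * R) : R :=
  Num.sqrt ((x.1 - y.1) ^+ 2 + (x.2 - y.2) ^+ 2).

Definition set_dist (R : realType) (A B : set (R * R)) : R :=
  inf [set eucl_dist x y | x in A & y in B].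

Definition area (R : realType) (A : set (R * R)) : \bar R :=
  (lebesgue_measure \x lebesgue_measure)%E A.

(* R^o is R seen as a module over itself: it provides the vector space
   structure of the plane. *)
Definition convex_plane (R : realType) (A : set (R * R)) : Prop :=
  @convex_set R (R^o * R^o)%type A.

Definition convex_hull (R : realType) (A : set (R * R)) : set (R * R) :=
  smallest (@convex_plane R) A.

Definition boundary (R : realType) (A : set (R * R)) : set (R * R) :=
  closure A `\` interior A.

Definition convex_body (R : realType) (P : set (R * R)) : Prop :=
  [/\ compact P, convex_plane P & interior P !=set0].

Definition line (R : realType) (u : R * R) (h : R) : set (R * R) :=
  [set x | dotp u x = h].

Definition supporting (R : realType) (P : set (R * R)) (u : R * R) (h : R) :
    Prop :=
  P `&` line u h !=set0 /\
  ((forall x, P x -> dotp u x <= h) \/ (forall x, P x -> h <= dotp u x)).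

(* Parallel lines are exactly those that can be written with a common unit
   normal vector u. *)
Definition constant_width (R : realType) (w : R) (P : set (R * R)) : Prop :=
  forall (u : R * R) (h k : R), dotp u u = 1 ->
    supporting P u h -> supporting P u k -> line u h <> line u k ->
    set_dist (line u h) (line u k) = w.

Definition unit_circle_point (R : realType) (c : R * R) (theta : R) : R * R :=
  (c.1 + cos theta, c.2 + sin theta).

Definition unit_arc (R : realType) (c : R * R) (s t : R) : set (R * R) :=
  [set unit_circle_point c theta | theta in `[s, t]].

(* The boundary of P, traversed counterclockwise, consists of n arcs: the i-th
   one has centre c i, spans the angles from s i to t i, and goes from v i to
   v (i + 1), indices being cyclic (ordS). Since the centres lie in the convex
   set P, counterclockwise around P means counterclockwise around each centre.
   Consecutive arcs lie on different circles; otherwise they would form a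
   single arc, and the vertices would depend on how arcs are subdivided. *)
Definition arc_boundary (R : realType) (P : set (R * R)) (n : nat)
    (v c : 'I_n -> R * R) (s t : 'I_n -> R) : Prop :=
  [/\ injective v,
      forall i, s i < t i < s i + 2 * pi,
      forall i, v i = unit_circle_point (c i) (s i) /\
                v (ordS i) = unit_circle_point (c i) (t i),
      forall i, c i <> c (ordS i) &
      boundary P = \bigcup_(i in [set: 'I_n]) unit_arc (c i) (s i) (t i)].

(* P is a Reuleaux polygon of width 1 and V is its set of vertices. *)
Definition reuleaux_polygon (R : realType) (P V : set (R * R)) : Prop :=
  [/\ convex_body P, constant_width 1 P &
      exists (n : nat) (v c : 'I_n -> R * R) (s t : 'I_n -> R),
        [/\ odd n, (3 <= n)%N, arc_boundary P v c s t,
            V = range v & forall i, V (c i)]].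

(* The skeleton, as a function of the vertex set. *)
Definition skeleton (R : realType) (V : set (R * R)) : set (R * R) :=
  convex_hull V.

Definition reuleaux_triangle (R : realType) (a b c : R * R) : set (R * R) :=
  [set x | [/\ eucl_dist a x <= 1, eucl_dist b x <= 1 & eucl_dist c x <= 1]].

(* Main.v *)
Require Import Defs.
From mathcomp Require Import all_boot all_order all_algebra.
From mathcomp Require Import all_classical all_reals all_analysis.
From mathcomp Require Import measurable_realfun ring lra.

Set Implicit Arguments.
Unset Strict Implicit.
Unset Printing Implicit Defensive.

Import Order.TTheory GRing.Theory Num.Theory.
Import numFieldNormedType.Exports.

Local Open Scope classical_set_scope.
Local Open Scope ring_scope.

(** Lower bound. Let [P] be a Reuleaux polygon with vertex set [V]. An arc has
angle at most [pi / 3], since its chord has length at most [1]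
([arc_angle_le]). In the direction of a unit vector [u] the two extreme points
of [P] are at height difference [1]; if one of them is not a vertex, it lies
inside an arc, directly above (or below) the centre of that arc, and the nearer
end of the arc is a vertex at height at least [cos (pi / 6) = sqrt 3 / 2] over
the centre. So the vertices have breadth at least [sqrt 3 / 2] in every
direction ([vertices_breadth]). A centre of an arc and an end of the same arc
are two vertices at distance [1]; together with two vertices that realise a
breadth of [sqrt 3 / 2] perpendicular to them they span a region of area at
least [1 / 2 * 1 * (sqrt 3 / 2)] ([area_ge_half_breadth]), which is the area of
the equilateral triangle of side [1] ([area_equilateral]).

Upper bound. A set of diameter at most [1] has area at most [pi / 4]
([isodiametric]). This is applied not to the skeleton but to its union with a
small square: every arc carries a point of [P] that is not in the skeleton,
because a point of a circle is extreme in the disk and only finitely many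
points of the arc are vertices. Near such a point there is a square contained
in [P] and disjoint from the skeleton, and [P] has diameter [1]
([area_skeleton_lt]).

The isodiametric inequality follows from Fubini's theorem used twice. If [l x]
is the length of the vertical section over [x], the area is the integral over
[t] of the measure of [{x | t < l x}]; two vertical sections longer than [t]
contain points whose ordinates differ by more than [t], so this level set has
diameter at most [sqrt (1 - t ^ 2)].

The Reuleaux triangle on [a], [b], [c] has constant width [1] because, up to
sign, each direction lies in the angle at one of the vertices between the two
sides: this vertex and its translate by the direction are then the two extreme
points of the triangle ([unit_breadth_cone]). *)

(** * Area of closed plane sets *)

Section PlaneMeasure.
Variable R : realType.
Notation mR := (measurableTypeR R).
Notation mu := (@lebesgue_measure R).

Lemma lebesgue_measure_shift (c : R) (A : set mR) : measurable A ->
  mu ((fun y => y + c) @^-1` A) = mu A.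
Proof.
move=> mA.
have mf : measurable_fun [set: mR] ((fun y => y + c) : mR -> mR).
  by apply: continuous_measurable_fun => y; apply: cvgD; [exact: cvg_id|exact: cvg_cst].
have [nu nuE] : exists nu : {measure set mR -> \bar R},
    forall B, nu B = mu ((fun y => y + c) @^-1` B).
  pose nu := pushforward mu ((fun y => y + c) : mR -> mR).
  by unshelve eexists (nu : {measure set _ -> \bar _}).
rewrite -nuE; apply/esym/lebesgue_measure_unique => // X [[a b] _ <-] /=.
rewrite nuE.
rewrite (_ : _ @^-1` _ = `](a - c), (b - c)]%classic); last first.
  by apply/seteqP; split => y /=; rewrite !in_itv/= ltrBlDr lerBrDr.
rewrite !lebesgue_measure_itv/= !lte_fin ltrD2r; case: ifP => // _.
by rewrite -!EFinB opprB addrA subrK.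
Qed.

(** The product sigma-algebra of the plane, fixed once: the type [R * R] alone
does not name the sigma-algebra on [R]. *)
Definition plane_measurable (A : set (R * R)) : Prop :=
  measurable (A : set (mR * mR)%type).

(** An open set is the union of the squares with rational centre and radius
that it contains, and these are countably many. *)
Lemma open_plane_measurable (U : set (R * R)) : open U -> plane_measurable U.
Proof.
move=> oU.
pose box (c d r : rat) : set (R * R) :=
  ball (ratr c : R) (ratr r) `*` ball (ratr d : R) (ratr r).
pose F c d r := if pselect (box c d r `<=` U) then box c d r else set0.
have -> : U = \bigcup_c \bigcup_d \bigcup_r F c d r.
  apply/seteqP; split => [[x y] Uxy|z [c _ [d _ [r _]]]]; last first.
    by rewrite /F; case: pselect => [bU /bU//|].
  move/nbhs_ballP : (open_nbhs_nbhs (conj oU Uxy)) => [e /= e0 eU].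
  have [r /andP[r0 re]] : exists r : rat, 0 < (ratr r : R) < e / 2.
    have [r] := @rat_in_itvoo R 0 (e / 2) ltac:(lra).
    by rewrite in_itv/= => h; exists r.
  have near_rat (t : R) : exists c : rat, `|ratr c - t| < ratr r.
    have [c] := @rat_in_itvoo R (t - ratr r) (t + ratr r) ltac:(lra).
    rewrite in_itv/= => /andP[h1 h2]; exists c.
    by rewrite ltr_norml; apply/andP; split; lra.
  have [c hc] := near_rat x; have [d hd] := near_rat y.
  exists c => //; exists d => //; exists r => //.
  rewrite /F; case: pselect => [bU|nU]; first by split; rewrite /ball/=.
  exfalso; apply: nU => -[x' y'] [] /= hx hy.
  apply: eU; rewrite /ball/=/prod_ball/= /ball/=.
  move: hx hy hc hd; rewrite /ball/= !ltr_norml.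
  by move=> /andP[? ?] /andP[? ?] /andP[? ?] /andP[? ?]; split; apply/andP; split; lra.
do 3 (apply: bigcupT_measurable_rat => ?).
rewrite /F; case: pselect => bU /=; last exact: measurable0.
by apply: measurableX; exact: measurable_ball.
Qed.

Lemma closed_plane_measurable (A : set (R * R)) : closed A -> plane_measurable A.
Proof.
move=> cA; rewrite /plane_measurable -[A]setCK; apply: measurableC.
by apply: open_plane_measurable; exact: closed_openC.
Qed.

Lemma area_xsection (A : set (R * R)) :
  area A = (\int[mu]_x mu (xsection A x))%E.
Proof. by []. Qed.

Lemma area_ysection (A : set (R * R)) : plane_measurable A ->
  area A = (\int[mu]_y mu (ysection A y))%E.
Proof.
move=> mA; have := @indic_fubini_tonelli _ _ mR mR R mu mu _ mA.
by rewrite indic_fubini_tonelli_FE// indic_fubini_tonelli_GE.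
Qed.

Lemma area_le (A B : set (R * R)) : plane_measurable A -> plane_measurable B ->
  A `<=` B -> (area A <= area B)%E.
Proof.
move=> mA mB AB; rewrite /area.
exact: (@le_measure _ _ _ (@lebesgue_measure R \x @lebesgue_measure R)%E _ _
  (mem_set mA) (mem_set mB) AB).
Qed.

Lemma closed_preimage (f : R * R -> R * R) (A : set (R * R)) :
  continuous f -> closed A -> closed (f @^-1` A).
Proof. by move=> cf cA; apply: (preimage_closed _ cA) => x _; exact: cf. Qed.

Lemma pair_continuous (f g : R * R -> R) : continuous f -> continuous g ->
  continuous (fun z => (f z, g z)).
Proof.
move=> cf cg z.
exact: (@cvg_pair _ _ _ (nbhs z) (nbhs (f z)) (nbhs (g z)) _ _ _ f g (cf z) (cg z)).
Qed.

Lemma fst_continuous : continuous (fun z : R * R => z.1).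
Proof. by move=> z; exact: cvg_fst. Qed.

Lemma snd_continuous : continuous (fun z : R * R => z.2).
Proof. by move=> z; exact: cvg_snd. Qed.

(** Each vertical section is translated, so its length is unchanged; [phi] may
be any function, which covers translations as well as linear shears. *)
Lemma area_vshear (phi : R -> R) (A : set (R * R)) : plane_measurable A ->
  area ((fun z => (z.1, z.2 + phi z.1)) @^-1` A) = area A.
Proof.
move=> mA; rewrite !area_xsection; apply: eq_integral => x _.
have mx := measurable_xsection x mA.
rewrite -(lebesgue_measure_shift (phi x) mx).
by congr (mu _); apply/seteqP; split => y; rewrite /xsection/= !inE.
Qed.

(** The same with horizontal sections. Here the preimage has to be measurable
for Fubini's theorem to apply, hence the continuity of [phi]. *)
Lemma area_hshear (phi : R -> R) (A : set (R * R)) :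
    continuous phi -> closed A ->
  area ((fun z => (z.1 + phi z.2, z.2)) @^-1` A) = area A.
Proof.
move=> cphi cA.
have mA := closed_plane_measurable cA.
rewrite !area_ysection//; last first.
  apply: closed_plane_measurable; apply: closed_preimage => //.
  apply: pair_continuous; last exact: snd_continuous.
  move=> z; apply: cvgD; first exact: cvg_fst.
  exact: (@continuous_comp _ _ _ snd phi z (@snd_continuous z) (cphi _)).
apply: eq_integral => y _.
have my := measurable_ysection y mA.
rewrite -(lebesgue_measure_shift (phi y) my).
by congr (mu _); apply/seteqP; split => x; rewrite /ysection/= !inE.
Qed.

End PlaneMeasure.

(** * Rigid motions *)

Section Rigid.
Variable R : realType.
Notation mR := (measurableTypeR R).
Notation mu := (@lebesgue_measure R).
Implicit Types (p e : R * R) (A K : set (R * R)).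

(** In complex notation the map [z |-> p + e * z]: a rotation followed by a
translation when [e] is a unit vector. *)
Definition rigid p e (z : R * R) : R * R :=
  (p.1 + (e.1 * z.1 - e.2 * z.2), p.2 + (e.2 * z.1 + e.1 * z.2)).

Lemma affine_continuous (a b c : R) :
  continuous (fun z : R * R => a + (b * z.1 + c * z.2)).
Proof.
move=> z; apply: cvgD; first exact: cvg_cst.
by apply: cvgD; apply: cvgM; solve [exact: cvg_cst | exact: cvg_fst | exact: cvg_snd].
Qed.

Lemma rigid_continuous p e : continuous (rigid p e).
Proof.
apply: pair_continuous; last exact: affine_continuous.
move=> z; rewrite (_ : (fun _ => _) = (fun z : R * R => p.1 + (e.1 * z.1 + (- e.2) * z.2))).
  exact: affine_continuous.
by apply/funext => w; rewrite mulNr.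
Qed.

(** A rotation by an angle [o] is a product of three shears: horizontal with
factor [- tan (o / 2)], vertical with factor [sin o], and the first one again.
The half-angle tangent is [e.2 / (1 + e.1)], which excludes the half-turn. *)
Lemma area_rot e A : closed A -> e.1 ^+ 2 + e.2 ^+ 2 = 1 -> e.1 != -1 ->
  area (rigid (0, 0) e @^-1` A) = area A.
Proof.
move=> cA e1 eN1; pose al := - e.2 / (1 + e.1).
have e10 : 1 + e.1 != 0 by rewrite addrC addr_eq0.
have cl : continuous (fun x : R => al * x).
  by move=> x; apply: cvgM; [exact: cvg_cst|exact: cvg_id].
pose Hs (z : R * R) := (z.1 + al * z.2, z.2).
pose Vs (z : R * R) := (z.1, z.2 + e.2 * z.1).
have cH : continuous Hs.
  apply: pair_continuous; last exact: snd_continuous.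
  move=> z; rewrite (_ : (fun _ => _) = (fun z : R * R => 0 + (1 * z.1 + al * z.2))).
    exact: affine_continuous.
  by apply/funext => w; rewrite add0r mul1r.
have cV : continuous Vs.
  apply: pair_continuous; first exact: fst_continuous.
  move=> z; rewrite (_ : (fun _ => _) = (fun z : R * R => 0 + (e.2 * z.1 + 1 * z.2))).
    exact: affine_continuous.
  by apply/funext => w; rewrite add0r mul1r addrC.
have cHA : closed (Hs @^-1` A) by apply: closed_preimage.
have cVHA : closed (Vs @^-1` (Hs @^-1` A)) by apply: closed_preimage.
transitivity (area (Hs @^-1` (Vs @^-1` (Hs @^-1` A)))).
  have als : 1 + al * e.2 = e.1.
    rewrite /al mulrAC -[X in X + _](divff e10) -mulrDl mulNr -expr2.
    rewrite (_ : _ + _ - _ = e.1 * (1 + e.1)); last by lra.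
    by rewrite mulfK.
  have alc : al * (1 + e.1) = - e.2 by rewrite /al divfK.
  congr area; apply/funext => -[x y]; rewrite /preimage/rigid/Hs/Vs/= !add0r.
  congr (A _); congr pair; last by rewrite -als; ring.
  transitivity ((1 + al * e.2) * x + al * (1 + (1 + al * e.2)) * y).
    by rewrite als alc; ring.
  by ring.
rewrite (area_hshear cl cVHA) (area_vshear (fun x => e.2 * x)).
  by rewrite (area_hshear cl cA).
exact: closed_plane_measurable.
Qed.

(** The half-turn is the square of a quarter-turn, and translations are shears
with constant displacement. *)
Lemma area_rigid p e A : closed A -> e.1 ^+ 2 + e.2 ^+ 2 = 1 ->
  area (rigid p e @^-1` A) = area A.
Proof.
move=> cA e1.
pose tr (z : R * R) := (p.1 + (1 * z.1 + 0 * z.2), p.2 + (0 * z.1 + 1 * z.2)).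
have ctr : continuous tr by apply: pair_continuous; exact: affine_continuous.
have ctA : closed (tr @^-1` A) by apply: closed_preimage.
have areatr : area (tr @^-1` A) = area A.
  pose T2 (z : R * R) := (z.1, z.2 + p.2).
  have cT2 : continuous T2.
    apply: pair_continuous; first exact: fst_continuous.
    by move=> z; apply: cvgD; [exact: cvg_snd | exact: cvg_cst].
  rewrite -(area_vshear (fun=> p.2) (closed_plane_measurable cA)).
  rewrite -(@area_hshear _ (fun=> p.1) (T2 @^-1` A)).
  - congr area; apply/seteqP; split => -[x y]; rewrite /T2/tr/= !mul0r !mul1r addr0 add0r.
      by rewrite addrC [y + _]addrC.
    by rewrite addrC [_ + p.2]addrC.
  - by move=> x; exact: cvg_cst.
  - exact: closed_preimage.
rewrite -areatr.
have [eN|eN] := eqVneq e.1 (-1); last first.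
  rewrite -(area_rot ctA e1 eN); congr area.
  by apply/seteqP; split => -[x y]; rewrite /rigid/tr/= !mul0r !mul1r !add0r addr0.
have e20 : e.2 = 0 by apply/eqP; rewrite -sqrf_eq0; move: e1; rewrite eN; lra.
pose q : R * R := (0, 1).
have q1 : q.1 ^+ 2 + q.2 ^+ 2 = 1 by rewrite /q/=; ring.
have qN : q.1 != -1 by rewrite /q/= eq_sym oppr_eq0 oner_eq0.
have cq : closed (rigid (0, 0) q @^-1` (tr @^-1` A)).
  by apply: closed_preimage => //; exact: rigid_continuous.
rewrite -(area_rot ctA q1 qN) -(area_rot cq q1 qN).
congr area; apply/funext => -[x y]; rewrite /preimage/rigid/tr/= eN e20.
by congr (A _); congr pair; ring.
Qed.

Lemma integral_affine (a b al be : R) : a < b ->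
  (\int[mu]_(x in `[a, b]) (al * x + be)%:E)%E =
  (al * (b ^+ 2 - a ^+ 2) / 2 + be * (b - a))%:E.
Proof.
move=> ab.
have dF (x : R) : is_derive x 1 (fun x : R => al / 2 * x ^+ 2 + be * x) (al * x + be).
  apply: is_derive_eq.
  by rewrite /GRing.scale/=; field.
have cF : continuous (fun x : R => al / 2 * x ^+ 2 + be * x).
  by move=> x; apply/differentiable_continuous/derivable1_diffP.
rewrite (@continuous_FTC2 _ _ (fun x : R => al / 2 * x ^+ 2 + be * x))//.
- by rewrite -EFinB; congr EFin; field.
- apply: continuous_subspaceT => x; apply: cvgD; last exact: cvg_cst.
  by apply: cvgM; [exact: cvg_cst|exact: cvg_id].
- split=> [x _||].
  + by have [] := dF x.
  + exact/cvg_at_right_filter/cF.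
  + exact/cvg_at_left_filter/cF.
- by move=> x _; rewrite derive1E; have [_ ->] := dF x.
Qed.

End Rigid.

(** * The isodiametric inequality *)

Section Isodiametric.
Variable R : realType.
Notation mR := (measurableTypeR R).
Notation mu := (@lebesgue_measure R).

(** The substitution [t = sin x] avoids the derivative of the arcsine, which is
infinite at the end point [1]. *)
Lemma integral_quarter_circle :
  (\int[mu]_(t in `[0%R, 1%R]) (Num.sqrt (1 - t ^+ 2))%:E)%E = (pi / 4)%:E.
Proof.
have pi0 : 0 < pi :> R := pi_gt0 R.
have pih : 0 < pi / 2 :> R by lra.
have sin' : derive1 (@sin R) = cos.
  by apply/funext => x; rewrite derive1E; have [_ ->] := is_derive_sin x.
pose G (t : R) := Num.sqrt (1 - t ^+ 2).
have cG : continuous G.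
  move=> t; apply: (@continuous_comp _ _ _ (fun t : R => 1 - t ^+ 2) (@Num.sqrt R)).
    by apply: cvgB; [exact: cvg_cst | apply: (@exprn_continuous _ 2)].
  exact: sqrt_continuous.
have := @integration_by_substitution_increasing R sin G 0 (pi / 2) (ltW pih).
rewrite sin0 sin_pihalf -/G => ->; first last.
- exact: continuous_subspaceT.
- split=> [x _||].
  + exact: derivable_sin.
  + exact/cvg_at_right_filter/continuous_sin.
  + exact/cvg_at_left_filter/continuous_sin.
- rewrite sin'; apply: cvgP; exact/cvg_at_left_filter/continuous_cos.
- rewrite sin'; apply: cvgP; exact/cvg_at_right_filter/continuous_cos.
- by rewrite sin' => x _; exact: continuous_cos.
- move=> x y; rewrite !in_itv/= => /andP[? ?] /andP[? ?] xy.
  by rewrite ltr_sin// in_itv/=; apply/andP; split; lra.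
transitivity (\int[mu]_(x in `[0%R, (pi / 2)%R]) (cos x ^+ 2)%:E)%E.
  apply: eq_integral => x; rewrite inE/= in_itv/= => /andP[x0 x1]; congr EFin.
  rewrite sin'; change (Num.sqrt (1 - sin x ^+ 2) * cos x = cos x ^+ 2).
  rewrite -cos2sin2 sqrtr_sqr ger0_norm ?expr2//.
  by apply: cos_ge0_pihalf; apply/andP; split; lra.
pose F (x : R) := (x + sin x * cos x) / 2.
have dF (x : R) : is_derive x 1 F (cos x ^+ 2).
  apply: is_derive_eq.
  have -> : cos x ^+ 2 = (1 + (cos x ^+ 2 - sin x ^+ 2)) / 2 :> R.
    rewrite sin2cos2; by field.
  by rewrite /GRing.scale/=; field.
have cF : continuous F.
  by move=> x; apply/differentiable_continuous/derivable1_diffP; have [] := dF x.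
rewrite (@continuous_FTC2 _ _ F)//.
- rewrite -EFinB /F sin0 cos_pihalf; congr EFin; by field.
- apply: continuous_subspaceT => x.
  apply: (@continuous_comp _ _ _ (@cos R) (fun t : R => t ^+ 2)).
    exact: continuous_cos.
  exact: exprn_continuous.
- split=> [x _||].
  + by have [] := dF x.
  + exact/cvg_at_right_filter/cF.
  + exact/cvg_at_left_filter/cF.
- by move=> x _; rewrite derive1E; have [_ ->] := dF x.
Qed.

(** The set is contained in an interval of length [d] that starts at its
infimum. *)
Lemma lebesgue_measure_le_diam (A : set mR) (d : R) : measurable A -> 0 <= d ->
  (forall x y, A x -> A y -> y - x <= d) -> (mu A <= d%:E)%E.
Proof.
move=> mA d0 dA.
have [->|/set0P[a Aa]] := eqVneq A set0; first by rewrite measure0 lee_fin.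
have lA : has_inf A.
  by split; [exists a | exists (a - d) => x /dA - /(_ _ Aa); lra].
have AI : A `<=` `[inf A, (inf A + d)]%classic.
  move=> x Ax; rewrite /= in_itv/=; apply/andP; split.
    by apply: ge_inf => //; case: lA.
  rewrite -lerBlDr; apply: lb_le_inf; first by exists a.
  by move=> y Ay; have := dA _ _ Ay Ax; lra.
apply: (@le_trans _ _ (mu `[inf A, (inf A + d)]%classic)).
  by apply: le_measure => //; rewrite inE.
rewrite lebesgue_measure_itv/= lte_fin; case: ifP => _; last by rewrite lee_fin.
by rewrite -EFinB lee_fin; lra.
Qed.

Lemma spread_points (A : set mR) (d : R) : measurable A -> 0 <= d ->
  (d%:E < mu A)%E -> exists x y, [/\ A x, A y & d < y - x].
Proof.
move=> mA d0 dA; apply: contrapT => nA; move: dA; apply/negP; rewrite -leNgt.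
apply: lebesgue_measure_le_diam => // x y Ax Ay.
by rewrite leNgt; apply/negP => h; apply: nA; exists x, y.
Qed.

(** Two intervals longer than [t], on vertical lines at horizontal distance
[u]: the oriented gaps from the bottom of each to the top of the other add up
to the sum of the two lengths, so one of them exceeds [t]. *)
Lemma crossing_sections (u t a b a' b' : R) : 0 <= t ->
  t < b - a -> t < b' - a' -> u ^+ 2 + (b' - a) ^+ 2 <= 1 ->
  u ^+ 2 + (a' - b) ^+ 2 <= 1 -> u ^+ 2 + t ^+ 2 <= 1.
Proof.
move=> t0 ab ab' h1 h2; have [h|h] := lerP t (b' - a); first by nra.
have h' : t <= b - a' by lra.
by nra.
Qed.

Lemma le_sqrt_circle (u t : R) : u ^+ 2 + t ^+ 2 <= 1 ->
  u <= Num.sqrt (1 - t ^+ 2).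
Proof.
move=> h; apply: (le_trans (ler_norm _)); rewrite -sqrtr_sqr.
by apply: ler_wsqrtr; lra.
Qed.

(** Layer-cake form of a double Steiner symmetrisation; see the introduction.
The set [B] below is the subgraph of the section length [l]: it has the same
vertical section lengths as [K], and its horizontal sections are the level sets
of [l]. *)
Lemma isodiametric (K : set (R * R)) : plane_measurable K ->
  (forall x y, K x -> K y -> (x.1 - y.1) ^+ 2 + (x.2 - y.2) ^+ 2 <= 1) ->
  (area K <= (pi / 4)%:E)%E.
Proof.
move=> mK dK.
pose l x := mu (xsection K x).
have ml : measurable_fun [set: mR] l by exact: measurable_fun_xsection.
(* Points with [0 <= z.2] only, so that the section over [x] is the half-open
   interval from [0] to [l x]. *)
pose B : set (mR * mR) := [set z | 0 <= z.2 /\ (z.2%:E < l z.1)%E].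
have mB : measurable B.
  have -> : B = (@snd mR mR @^-1` `[0%R, +oo[%classic) `&` [set z | (z.2%:E < l z.1)%E].
    by apply/seteqP; split => z; rewrite /B/= in_itv/= andbT.
  apply: measurableI.
    rewrite -[X in measurable X]setTI.
    by apply: measurable_snd => //; exact: measurable_itv.
  rewrite -[X in measurable X]setTI.
  apply: measurable_lte => //.
    by apply/measurable_EFinP; exact: measurable_snd.
  by apply: (measurableT_comp ml); exact: measurable_fst.
have xB x : mu (xsection B x) = l x.
  have : (0 <= l x)%E by exact: measure_ge0.
  rewrite (_ : xsection B x = [set t | 0 <= t /\ (t%:E < l x)%E]); last first.
    by apply/seteqP; split => t; rewrite /xsection/= inE.
  case: (l x) => [r| |]//.
    rewrite lee_fin => r0; rewrite (_ : [set _ | _] = `[0, r[%classic).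
      rewrite lebesgue_measure_itv/= lte_fin; case: ltP => //; first by rewrite sube0.
      by move=> r0'; congr EFin; lra.
    by apply/seteqP; split => t /=; rewrite in_itv/= lte_fin => /andP.
  move=> _; rewrite (_ : [set _ | _] = `[(0 : R), +oo[%classic).
    by rewrite lebesgue_measure_itv/= ?ltry ?sube0.
  by apply/seteqP; split => t /=; rewrite in_itv/= andbT ltry => // -[].
have -> : area K = (\int[mu]_t mu (ysection B t))%E.
  rewrite -(area_ysection mB) !area_xsection; apply: eq_integral => x _.
  by rewrite xB.
pose g (t : R) := (Num.sqrt (1 - t ^+ 2))%:E.
rewrite -integral_quarter_circle [leRHS]integral_mkcond.
have mg : measurable_fun [set: mR] (g : mR -> \bar R).
  apply/measurable_EFinP; apply: continuous_measurable_fun => t.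
  apply: (@continuous_comp _ _ _ (fun t : R => 1 - t ^+ 2) (@Num.sqrt R)).
    by apply: cvgB; [exact: cvg_cst | apply: (@exprn_continuous _ 2)].
  exact: sqrt_continuous.
apply: ge0_le_integral => //.
- exact: measurable_fun_ysection.
- apply: (measurable_restrictT _ _).1 => //; exact: measurable_funTS.
move=> t _; rewrite patchE.
have yE : ysection B t = [set x | 0 <= t /\ (t%:E < l x)%E].
  by apply/seteqP; split => x; rewrite /ysection/= inE.
have key x x' : ysection B t x -> ysection B t x' ->
    0 <= t /\ (x' - x) ^+ 2 + t ^+ 2 <= 1.
  rewrite yE => -[t0 tx] [_ tx']; split=> //.
  have mx u : measurable (xsection K u) by exact: measurable_xsection.
  have [a [b [Ka Kb ab]]] := spread_points (mx x) t0 tx.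
  have [a' [b' [Ka' Kb' ab']]] := spread_points (mx x') t0 tx'.
  move: Ka Kb Ka' Kb'; rewrite /xsection/= !inE => Ka Kb Ka' Kb'.
  have := dK _ _ Ka' Kb; have := dK _ _ Kb' Ka => /= h1 h2.
  exact: (crossing_sections t0 ab ab' h1 h2).
case: ifPn => [|tN].
  rewrite inE/= in_itv/= => /andP[t0 t1].
  apply: lebesgue_measure_le_diam.
  - exact: measurable_ysection.
  - exact: sqrtr_ge0.
  - move=> x x' Bx Bx'; have [_ h] := key _ _ Bx Bx'.
    exact: le_sqrt_circle.
rewrite (_ : ysection B t = set0) ?measure0//.
apply/seteqP; split=> // x Bx; have [t0 h] := key _ _ Bx Bx.
move/negP: tN; apply; rewrite inE/= in_itv/= t0/=.
by rewrite -(@ler_pXn2r R 2) ?nnegrE// expr1n; move: h; rewrite subrr expr0n/= add0r.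
Qed.

End Isodiametric.

(** * Convex hulls of finite sets *)

Section Hull.
Variable R : realType.
Implicit Types (p q x y z : R * R) (s : seq (R * R)) (A K V : set (R * R)).

(** Convex combination on coordinates, with [t] the weight of the first point.
*)
Definition mix (t : R) x y : R * R :=
  (t * x.1 + (1 - t) * y.1, t * x.2 + (1 - t) * y.2).

Lemma convex_planeP A : convex_plane A <->
  forall x y, A x -> A y -> forall t : R, 0 <= t -> t <= 1 -> A (mix t x y).
Proof.
split=> [cA x y Ax Ay t t0 t1|cA x y l].
  by have := cA x y (Itv01 t0 t1) (mem_set Ax) (mem_set Ay); rewrite inE.
rewrite !inE => Ax Ay.
exact: (cA _ _ Ax Ay l%:num (ge0 l) (le1 l)).
Qed.

Lemma mix_continuous p : continuous (fun u : R * (R * R) => mix u.1 p u.2).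
Proof.
have c1 : continuous (fun u : R * (R * R) => u.1) by move=> u; exact: cvg_fst.
have c2 : continuous (fun u : R * (R * R) => u.2.1).
  move=> u; apply: (@continuous_comp _ _ _ (@snd R (R * R)%type) (@fst R R)).
    exact: cvg_snd.
  exact: cvg_fst.
have c3 : continuous (fun u : R * (R * R) => u.2.2).
  move=> u; apply: (@continuous_comp _ _ _ (@snd R (R * R)%type) (@snd R R)).
    exact: cvg_snd.
  exact: cvg_snd.
have cmix (a : R) (f : R * (R * R) -> R) : continuous f ->
    continuous (fun u : R * (R * R) => u.1 * a + (1 - u.1) * f u).
  move=> cf u; apply: cvgD; first by apply: cvgM; [exact: c1|exact: cvg_cst].
  apply: cvgM; last exact: cf.
  by apply: cvgB; [exact: cvg_cst | exact: c1].
move=> u.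
exact: (@cvg_pair _ _ _ (nbhs u) (nbhs _) (nbhs _) _ _ _ _ _
  (@cmix p.1 _ c2 u) (@cmix p.2 _ c3 u)).
Qed.

(** The hull of [p :: s] as the cone of segments from [p] to the hull of [s]: a
continuous image of a compact set, which is what makes hulls of finite sets
compact and hence measurable. *)
Fixpoint cone_hull p s : set (R * R) :=
  if s is q :: s' then
    (fun u : R * (R * R) => mix u.1 p u.2) @` (`[0, 1]%classic `*` cone_hull q s')
  else [set p].

Lemma cone_hull_compact p s : compact (cone_hull p s).
Proof.
elim: s p => [|q s IH] p /=; first exact: compact_set1.
apply: continuous_compact.
  by apply: continuous_subspaceT; exact: mix_continuous.
by apply: compact_setX; [exact: segment_compact | exact: IH].
Qed.

Lemma cone_hull_nonempty p s : cone_hull p s !=set0.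
Proof.
elim: s p => [|q s IH] p /=; first by exists p.
have [z hz] := IH q; exists (mix 0 p z); exists (0, z) => //=.
by split => //=; rewrite in_itv/= lexx ler01.
Qed.

(** A combination of points of two segments from [p] regroups as a combination
of [p] and of a mix of the two far ends; the weights of that mix are undefined
only if the result is [p] itself. *)
Lemma cone_hull_convex p s : convex_plane (cone_hull p s).
Proof.
elim: s p => [|q s IH] p; apply/convex_planeP => /=.
  by move=> x y -> -> t _ _; rewrite /mix -!mulrDl addrC subrK !mul1r; case: (p).
have /convex_planeP cq := IH q.
move=> _ _ [[t z] /= [+ hz] <-] [[t' z'] /= [+ hz'] <-] l l0 l1.
rewrite !in_itv/= => /andP[t0 t1] /andP[t'0 t'1].
pose T := l * t + (1 - l) * t'.
have T0 : 0 <= T by rewrite /T; nra.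
have T1 : T <= 1 by rewrite /T; nra.
pose a := l * (1 - t); pose b := (1 - l) * (1 - t').
have a0 : 0 <= a by rewrite /a; nra.
have b0 : 0 <= b by rewrite /b; nra.
have ab : a + b = 1 - T by rewrite /a /b /T; ring.
have [Te|Tn] := eqVneq T 1.
  exists (T, z) => /=; first by rewrite in_itv/= T0 T1.
  have [ae be] : a = 0 /\ b = 0 by split; lra.
  rewrite /mix/= Te; congr pair.
    transitivity (T * p.1 + a * z.1 + b * z'.1); first by rewrite ae be Te; ring.
    by rewrite /T /a /b; ring.
  transitivity (T * p.2 + a * z.2 + b * z'.2); first by rewrite ae be Te; ring.
  by rewrite /T /a /b; ring.
have Tp : 0 < 1 - T by rewrite subr_gt0 lt_neqAle Tn.
have Tz : 1 - T != 0 by rewrite gt_eqF.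
have bE : 1 - a / (1 - T) = b / (1 - T).
  by rewrite -[X in X - _](divff Tz) -mulrBl -ab; congr (_ / _); ring.
exists (T, mix (a / (1 - T)) z z') => /=.
  split; first by rewrite /= in_itv/= T0 T1.
  apply: cq => //; first by rewrite divr_ge0 // ltW.
  by rewrite ler_pdivrMr // mul1r; lra.
rewrite /mix/= bE; congr pair.
  transitivity (T * p.1 + (a * z.1 + b * z'.1)); first by congr (_ + _); field.
  by rewrite /T /a /b; ring.
transitivity (T * p.2 + (a * z.2 + b * z'.2)); first by congr (_ + _); field.
by rewrite /T /a /b; ring.
Qed.

Lemma cone_hull_vertex p s x : x \in p :: s -> cone_hull p s x.
Proof.
elim: s p => [|q s IH] p; first by rewrite inE => /eqP.
rewrite inE => /orP[/eqP ->|xs].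
  have [z hz] := cone_hull_nonempty q s; exists (1, z) => /=.
    by split => //=; rewrite in_itv/= lexx ler01.
  by rewrite /mix/= subrr !mul0r !mul1r !addr0; case: (p).
exists (0, x) => /=.
  by split; [rewrite /= in_itv/= lexx ler01 | exact: IH].
by rewrite /mix/= subr0 !mul0r !mul1r !add0r; case: (x).
Qed.

Lemma cone_hull_min p s A : convex_plane A -> {subset p :: s <= [pred x | x \in A]} ->
  cone_hull p s `<=` A.
Proof.
move=> cA; elim: s p => [|q s IH] p sA /=.
  by move=> _ ->; have := sA p; rewrite mem_head => /(_ isT); rewrite !inE.
move=> _ [[t z] /= [+ hz] <-]; rewrite in_itv/= => /andP[t0 t1].
move/convex_planeP : (cA); apply => //.
  by have := sA p; rewrite mem_head => /(_ isT); rewrite !inE.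
by apply: (IH q) => // x xs; apply: sA; rewrite inE xs orbT.
Qed.

Lemma sub_convex_hull V : V `<=` convex_hull V.
Proof. exact: sub_smallest. Qed.

Lemma convex_hull_min V A : convex_plane A -> V `<=` A -> convex_hull V `<=` A.
Proof. by move=> cA VA; exact: smallest_sub. Qed.

Lemma convex_convex_hull V : convex_plane (convex_hull V).
Proof.
apply/convex_planeP => x y hx hy t t0 t1 A [cA VA].
by move/convex_planeP : (cA); apply => //; [apply: hx | apply: hy].
Qed.

Lemma finite_convex_hull_compact V : finite_set V -> compact (convex_hull V).
Proof.
move=> /finite_seqP[[|p s] ->].
  rewrite (_ : convex_hull _ = set0); first exact: compact0.
  by rewrite -subset0; apply: convex_hull_min => // x y l /set_mem.
rewrite (_ : convex_hull _ = cone_hull p s); first exact: cone_hull_compact.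
apply/seteqP; split.
  apply: convex_hull_min; first exact: cone_hull_convex.
  by move=> x /=; exact: cone_hull_vertex.
apply: cone_hull_min; first exact: convex_convex_hull.
by move=> x xs; rewrite !inE; apply: sub_convex_hull; exact: xs.
Qed.

Lemma plane_hausdorff : hausdorff_space (R * R)%type.
Proof. exact: norm_hausdorff. Qed.

Lemma finite_convex_hull_closed V : finite_set V -> closed (convex_hull V).
Proof.
move=> fV; apply: compact_closed; first exact: plane_hausdorff.
exact: finite_convex_hull_compact.
Qed.

End Hull.

(** * Kites and triangles in normal position *)

Section Areas.
Variable R : realType.
Notation mR := (measurableTypeR R).
Notation mu := (@lebesgue_measure R).
Implicit Types (A K V : set (R * R)).

Lemma section_length K (x u v : R) : convex_plane K -> plane_measurable K ->
  K (x, u) -> K (x, v) -> ((v - u)%:E <= mu (xsection K x))%E.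
Proof.
move=> /convex_planeP cK mK Ku Kv.
have [vu|uv] := leP v u.
  by apply: (@le_trans _ _ 0%E); [rewrite lee_fin; lra | exact: measure_ge0].
have vu0 : v - u != 0 by rewrite subr_eq0 gt_eqF.
apply: (@le_trans _ _ (mu `[u, v]%classic)).
  by rewrite lebesgue_measure_itv/= lte_fin uv -EFinB.
apply: le_measure; rewrite ?inE.
- exact: measurable_itv.
- exact: measurable_xsection.
move=> w /=; rewrite in_itv/= => /andP[uw wv]; rewrite /xsection/= inE.
have := cK _ _ Kv Ku ((w - u) / (v - u)); rewrite /mix/=.
have -> : (w - u) / (v - u) * x + (1 - (w - u) / (v - u)) * x = x by ring.
have -> : (w - u) / (v - u) * v + (1 - (w - u) / (v - u)) * u = w by field.
by apply; [apply: divr_ge0; lra | rewrite ler_pdivrMr; lra].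
Qed.

(** Over the fraction [x / h] of the way to the apex [(h, y)], the section
contains that of the triangle with base the unit segment on the vertical axis.
*)
Lemma section_length_apex K (h y x : R) : convex_plane K -> plane_measurable K ->
  K (0, 0) -> K (0, 1) -> K (h, y) -> h != 0 -> 0 <= x / h -> x / h <= 1 ->
  ((1 - x / h)%:E <= mu (xsection K x))%E.
Proof.
move=> cK mK K0 K1 Kh h0 t0 t1.
have /convex_planeP cK' := cK.
have xh : x / h * h = x by rewrite divfK.
have Ku : K (x, x / h * y).
  have := cK' _ _ Kh K0 _ t0 t1; rewrite /mix/=.
  by rewrite !mulr0 !addr0 xh.
have Kv : K (x, x / h * y + (1 - x / h)).
  have := cK' _ _ Kh K1 _ t0 t1; rewrite /mix/=.
  by rewrite !mulr0 !addr0 mulr1 xh.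
by have := section_length cK mK Ku Kv; rewrite addrAC subrr add0r.
Qed.

(** The two triangles on the common unit base, on the right and on the left of
it, are measured by integrating their sections over disjoint intervals. *)
Lemma kite_area K (h y h' y' : R) : convex_plane K -> plane_measurable K ->
  0 <= h -> 0 <= h' ->
  K (0, 0) -> K (0, 1) -> K (h, y) -> K (- h', y') ->
  (((h + h') / 2)%:E <= area K)%E.
Proof.
move=> cK mK h0 h'0 K0 K1 Kh Kh'.
pose l x := mu (xsection K x).
have ml : measurable_fun [set: mR] l by exact: measurable_fun_xsection.
have l0 x : (0 <= l x)%E by exact: measure_ge0.
have maff (a b : R) : measurable_fun [set: mR] (fun x : mR => (a * x + b)%:E).
  apply/measurable_EFinP; apply: continuous_measurable_fun => x.
  by apply: cvgD; [apply: cvgM; [exact: cvg_cst|exact: cvg_id]|exact: cvg_cst].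
have right : ((h / 2)%:E <= \int[mu]_(x in `[0%R, h]) l x)%E.
  move: h0; rewrite le_eqVlt => /predU1P[<-|h0].
    by rewrite mul0r; apply: integral_ge0.
  have hn : h != 0 by rewrite gt_eqF.
  have -> : (h / 2)%:E = (\int[mu]_(x in `[0%R, h]) ((- h^-1) * x + 1)%:E)%E.
    by rewrite integral_affine//; congr EFin; field.
  apply: ge0_le_integral => //.
  + move=> x /=; rewrite in_itv/= => /andP[x0 xh]; rewrite lee_fin mulNr.
    by rewrite mulrC addrC subr_ge0 ler_pdivrMr// mul1r.
  + exact: measurable_funTS.
  + exact: measurable_funTS.
  + move=> x /=; rewrite in_itv/= => /andP[x0 xh].
    rewrite (_ : - h^-1 * x + 1 = 1 - x / h); last by ring.
    apply: (section_length_apex cK mK K0 K1 Kh hn).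
      by rewrite divr_ge0// ltW.
    by rewrite ler_pdivrMr// mul1r.
have left : ((h' / 2)%:E <= \int[mu]_(x in `[(- h')%R, 0%R[) l x)%E.
  rewrite integral_itv_bndo_bndc; last exact: measurable_funTS.
  move: h'0; rewrite le_eqVlt => /predU1P[<-|h'0].
    by rewrite mul0r; apply: integral_ge0.
  have hn : - h' != 0 by rewrite oppr_eq0 gt_eqF.
  have hn' : h' != 0 by rewrite gt_eqF.
  have -> : (h' / 2)%:E = (\int[mu]_(x in `[(- h')%R, 0%R]) (h'^-1 * x + 1)%:E)%E.
    by rewrite integral_affine//; [congr EFin; field | lra].
  have fr (x : R) : - h' <= x -> x <= 0 -> 0 <= x / - h' /\ x / - h' <= 1.
    move=> xh x0; have -> : x / - h' = - x / h' by field; rewrite ?hn ?hn'.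
    by rewrite ler_pdivrMr// divr_ge0 ?mul1r ?(ltW h'0)//; [split=> //; lra|lra].
  apply: ge0_le_integral => //.
  + move=> x /=; rewrite in_itv/= => /andP[/fr /[apply] -[f0 f1]]; rewrite lee_fin.
    by rewrite (_ : h'^-1 * x + 1 = 1 - x / - h'); [lra|field; rewrite ?hn ?hn'].
  + exact: measurable_funTS.
  + exact: measurable_funTS.
  + move=> x /=; rewrite in_itv/= => /andP[/fr /[apply] -[f0 f1]].
    rewrite (_ : h'^-1 * x + 1 = 1 - x / - h'); last by field; rewrite ?hn ?hn'.
    exact: (section_length_apex cK mK K0 K1 Kh' hn).
apply: (@le_trans _ _ (\int[mu]_(x in `[(- h')%R, 0%R[ `|` `[0%R, h]) l x)%E).
  rewrite ge0_integral_setU//=.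
  - by rewrite addrC mulrDl EFinD; apply: leeD.
  - exact: measurable_funTS.
  - rewrite disj_set2E; apply/eqP; rewrite -subset0 => x [] /=.
    by rewrite !in_itv/= => /andP[_ ?] /andP[? _]; lra.
rewrite area_xsection; apply: ge0_subset_integral => //.
exact: measurableU.
Qed.

(** The isosceles triangle with base from [(0, 0)] to [(0, 1)] and apex [(h, 1
/ 2)]. *)
Definition canonical_triangle (h : R) : set (R * R) :=
  [set z | [/\ 0 <= z.1, z.1 <= h, z.1 / (2 * h) <= z.2 & z.2 <= 1 - z.1 / (2 * h)]].

Lemma canonical_triangle_convex (h : R) : convex_plane (canonical_triangle h).
Proof.
apply/convex_planeP => -[x1 x2] [y1 y2]; rewrite /canonical_triangle/mix/=.
move: (2 * h)^-1 => k [a b c d] [a' b' c' d'] t t0 t1; split; nra.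
Qed.

Lemma canonical_triangle_measurable (h : R) : plane_measurable (canonical_triangle h).
Proof.
apply: closed_plane_measurable.
have cl (a b c : R) : closed [set z : R * R | 0 <= a + (b * z.1 + c * z.2)].
  rewrite (_ : mkset _ = (fun z : R * R => a + (b * z.1 + c * z.2)) @^-1` [set u | 0 <= u]) //.
  by apply: preimage_closed; [move=> z _; exact: affine_continuous | exact: closed_ge].
rewrite (_ : canonical_triangle h =
   [set z : R * R | 0 <= 0 + (1 * z.1 + 0 * z.2)] `&`
   [set z : R * R | 0 <= h + ((-1) * z.1 + 0 * z.2)] `&`
   [set z : R * R | 0 <= 0 + (- (2 * h)^-1 * z.1 + 1 * z.2)] `&`
   [set z : R * R | 0 <= 1 + (- (2 * h)^-1 * z.1 + (-1) * z.2)]).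
  by do 3 (apply: closedI; last exact: cl); exact: cl.
apply/seteqP; split => -[x y]; rewrite /canonical_triangle/=; move: (2 * h)^-1 => k.
  by move=> [? ? ? ?]; repeat split; lra.
by move=> [[[? ?] ?] ?]; split; lra.
Qed.

Lemma area_canonical_triangle (h : R) : 0 < h ->
  (area (canonical_triangle h) <= (h / 2)%:E)%E.
Proof.
move=> h0; have hn : h != 0 by rewrite gt_eqF.
have -> : (h / 2)%:E = (\int[mu]_(x in `[0%R, h]) ((- h^-1) * x + 1)%:E)%E.
  by rewrite integral_affine//; congr EFin; field.
rewrite area_xsection [leRHS]integral_mkcond.
apply: ge0_le_integral => //.
- exact: (measurable_fun_xsection _ (canonical_triangle_measurable h)).
- apply: (measurable_restrictT _ _).1 => //; apply: measurable_funTS.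
  apply/measurable_EFinP; apply: continuous_measurable_fun => x.
  by apply: cvgD; [apply: cvgM; [exact: cvg_cst|exact: cvg_id]|exact: cvg_cst].
move=> x _; rewrite patchE; case: ifPn => [|xN].
  rewrite inE/= in_itv/= => /andP[x0 xh].
  apply: (@le_trans _ _ (mu `[x / (2 * h), (1 - x / (2 * h))]%classic)).
    apply: le_measure; rewrite ?inE.
    + exact: (measurable_xsection _ (canonical_triangle_measurable h)).
    + exact: measurable_itv.
    + move=> y; rewrite /xsection/= inE => -[/= _ _ ? ?].
      by rewrite in_itv/=; apply/andP.
  rewrite lebesgue_measure_itv/= lte_fin; case: ifP => _.
    by rewrite -EFinB lee_fin le_eqVlt; apply/orP; left; apply/eqP; field.
  rewrite lee_fin (_ : - h^-1 * x + 1 = (h - x) / h); last by field.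
  by apply: divr_ge0; lra.
rewrite (_ : xsection _ _ = set0) ?measure0//.
apply/seteqP; split=> // y; rewrite /xsection/= inE => -[/= x0 xh _ _].
by move/negP: xN; apply; rewrite inE/= in_itv/= x0.
Qed.

End Areas.

(** * Areas of hulls with points at unit distance *)

Section Diameter.
Variable R : realType.
Implicit Types (p q x y z : R * R) (A K V : set (R * R)).

Definition sqdist x y : R := (x.1 - y.1) ^+ 2 + (x.2 - y.2) ^+ 2.

Lemma sqdist_ge0 x y : 0 <= sqdist x y.
Proof. by rewrite /sqdist addr_ge0 ?sqr_ge0. Qed.

Lemma sqdistC x y : sqdist x y = sqdist y x.
Proof. by rewrite /sqdist; ring. Qed.

Lemma eucl_dist_le1 x y : (eucl_dist x y <= 1) = (sqdist x y <= 1).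
Proof. by rewrite /eucl_dist -[X in _ <= X]sqrtr1 ler_sqrt. Qed.

Lemma eucl_dist_eq1 x y : eucl_dist x y = 1 <-> sqdist x y = 1.
Proof.
rewrite /eucl_dist -/(sqdist x y); split=> [h|->]; last exact: sqrtr1.
by rewrite -[LHS]sqr_sqrtr ?sqdist_ge0// h expr1n.
Qed.

(** The squared distance to [z] is a convex function: a combination falls short
of the weighted mean of the values by [t * (1 - t)] times the squared distance
of [x] and [y]. *)
Lemma sqdist_mix_le z x y (t : R) : sqdist z x <= 1 -> sqdist z y <= 1 ->
  0 <= t -> t <= 1 -> sqdist z (mix t x y) <= 1.
Proof.
move=> zx zy t0 t1.
have -> : sqdist z (mix t x y) =
    t * sqdist z x + (1 - t) * sqdist z y - t * (1 - t) * sqdist x y.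
  by rewrite /sqdist/mix/=; ring.
have := sqdist_ge0 x y; move: zx zy.
move: (sqdist z x) (sqdist z y) (sqdist x y) => a b e a1 b1 e0.
have : 0 <= t * (1 - t) * e by rewrite mulr_ge0// mulr_ge0// subr_ge0.
nra.
Qed.

(** The vector [q - p] turned clockwise by a right angle. It is chosen so that
[rigid p (normal p q)] sends [(0, 1)] to [q]: the segment from [p] to [q]
becomes the base on the vertical axis. *)
Definition normal p q : R * R := ((q.2 - p.2), - (q.1 - p.1)).

Lemma dotp_normal p q : dotp (normal p q) (normal p q) = sqdist p q.
Proof. by rewrite /dotp/normal/sqdist/=; ring. Qed.

Lemma rigid_convex p e A : convex_plane A -> convex_plane (rigid p e @^-1` A).
Proof.
move=> /convex_planeP cA; apply/convex_planeP => x y Ax Ay t t0 t1.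
rewrite /preimage/=; have := cA _ _ Ax Ay t t0 t1.
by congr A; rewrite /rigid/mix/=; congr pair; ring.
Qed.

(** The coordinates of [z] in the frame where the segment from [p] to [q] is
the vertical base. *)
Lemma rigid_normalK p q z : sqdist p q = 1 ->
  rigid p (normal p q) (dotp (normal p q) z - dotp (normal p q) p,
    (q.1 - p.1) * (z.1 - p.1) + (q.2 - p.2) * (z.2 - p.2)) = z.
Proof.
rewrite /sqdist => h; case: z => z1 z2; rewrite /rigid/dotp/normal/=.
move: h; move: (p.1) (p.2) (q.1) (q.2) => p1 p2 q1 q2 h.
congr pair.
  transitivity (p1 + ((p1 - q1) ^+ 2 + (p2 - q2) ^+ 2) * (z1 - p1)); first by ring.
  by rewrite h; ring.
transitivity (p2 + ((p1 - q1) ^+ 2 + (p2 - q2) ^+ 2) * (z2 - p2)); first by ring.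
by rewrite h; ring.
Qed.

Lemma normal_unit p q : sqdist p q = 1 ->
  (normal p q).1 ^+ 2 + (normal p q).2 ^+ 2 = 1.
Proof. by move=> <-; rewrite /normal/sqdist/=; ring. Qed.

(** The triangles on the unit segment from [p] to [q] with apexes [x] and [y]
lie in [K] on either side of the segment, and their heights add up to the
breadth. If [x] and [y] are on the same side of the segment, the base itself
serves as a degenerate triangle on the other side. *)
Lemma area_ge_half_breadth K p q x y : closed K -> convex_plane K ->
  K p -> K q -> K x -> K y -> sqdist p q = 1 ->
  (((dotp (normal p q) x - dotp (normal p q) y) / 2)%:E <= area K)%E.
Proof.
move=> cK vK Kp Kq Kx Ky pq1.
set n := normal p q; pose H z := dotp n z - dotp n p.
have nq : dotp n q = dotp n p by rewrite /n/dotp/normal/=; ring.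
rewrite -(area_rigid p cK (normal_unit pq1)) -/n.
have K'K z : K z -> exists u, (rigid p n @^-1` K) (H z, u).
  move=> Kz; exists ((q.1 - p.1) * (z.1 - p.1) + (q.2 - p.2) * (z.2 - p.2)).
  by rewrite /preimage/= /H rigid_normalK.
have vK' := @rigid_convex p n _ vK.
have mK' : plane_measurable (rigid p n @^-1` K).
  exact: closed_plane_measurable (closed_preimage (@rigid_continuous _ p n) cK).
have K0 : (rigid p n @^-1` K) (0, 0).
  by rewrite /preimage/rigid/= !mulr0 subr0 !addr0; case: (p) Kp.
have K1 : (rigid p n @^-1` K) (0, 1).
  rewrite /preimage/rigid/= !mulr0 !mulr1; case: (p) (q) Kq => p1 p2 [q1 q2] /=.
  by congr K; congr pair; ring.
(* A point on the wrong side of the base is replaced by [p]. *)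
have top : exists h u, [/\ 0 <= h, H x <= h & (rigid p n @^-1` K) (h, u)].
  have [Hx|Hx] := lerP 0 (H x).
    by have [u Ku] := K'K _ Kx; exists (H x), u.
  by exists 0, 0; split=> //; exact: ltW.
have bot : exists h u, [/\ 0 <= h, - H y <= h & (rigid p n @^-1` K) (- h, u)].
  have [Hy|Hy] := lerP (H y) 0.
    have [u Ku] := K'K _ Ky; exists (- H y), u; split => //; first by lra.
    by rewrite opprK.
  by exists 0, 0; split=> //; [lra|rewrite oppr0].
have [h [u [h0 hx Kh]]] := top; have [h' [u' [h'0 hy Kh']]] := bot.
apply: le_trans (kite_area vK' mK' h0 h'0 K0 K1 Kh Kh').
rewrite lee_fin; move: hx hy; rewrite /H; lra.
Qed.

(** In the frame of the side [a b] the third vertex has abscissa [sqrt 3 / 2];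
the sign hypothesis puts it on the right of that side. *)
Lemma area_equilateral_ge_half (a b c : R * R) :
  sqdist a b = 1 -> sqdist b c = 1 -> sqdist c a = 1 ->
  0 <= dotp (normal a b) c - dotp (normal a b) a ->
  (area (convex_hull [set a; b; c]) <= (Num.sqrt 3 / 4)%:E)%E.
Proof.
move=> ab bc ca; set n := normal a b => H0.
have s30 : 0 < Num.sqrt 3 :> R by rewrite sqrtr_gt0.
have s3 : Num.sqrt 3 ^+ 2 = 3 :> R by rewrite sqr_sqrtr.
pose H (z : R * R) := dotp n z - dotp n a.
pose L (z : R * R) := (b.1 - a.1) * (z.1 - a.1) + (b.2 - a.2) * (z.2 - a.2).
have Lc : L c = 1 / 2.
  move: ab bc ca; rewrite /sqdist /L => ab bc ca.
  have -> : (b.1 - a.1) * (c.1 - a.1) + (b.2 - a.2) * (c.2 - a.2) =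
    (((a.1 - b.1) ^+ 2 + (a.2 - b.2) ^+ 2) + ((c.1 - a.1) ^+ 2 + (c.2 - a.2) ^+ 2)
     - ((b.1 - c.1) ^+ 2 + (b.2 - c.2) ^+ 2)) / 2 by field.
  by rewrite ab bc ca; field.
have Hc2 : H c ^+ 2 = 3 / 4.
  have : H c ^+ 2 + L c ^+ 2 = sqdist a b * sqdist c a.
    by rewrite /H /L /n /sqdist /dotp /normal /=; ring.
  by rewrite ab ca Lc; lra.
have Hc : H c = Num.sqrt 3 / 2.
  have : (H c - Num.sqrt 3 / 2) * (H c + Num.sqrt 3 / 2) = 0.
    by rewrite -subr_sqr Hc2 expr_div_n s3; field.
  move/eqP; rewrite mulf_eq0 => /orP[|] /eqP h; first by lra.
  by move: H0; rewrite -/(H c); lra.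
set h := Num.sqrt 3 / 2 in Hc.
have h0 : 0 < h by rewrite /h; lra.
have hV : h / (2 * h) = 1 / 2 by field; rewrite gt_eqF.
have fin : finite_set [set a; b; c] by [].
have cH := finite_convex_hull_closed fin.
rewrite -(area_rigid a cH (normal_unit ab)) -/n.
apply: (@le_trans _ _ (area (canonical_triangle h))); last first.
  apply: le_trans (area_canonical_triangle h0) _.
  by rewrite lee_fin /h; lra.
apply: area_le; [|exact: canonical_triangle_measurable|].
  exact: closed_plane_measurable (closed_preimage (@rigid_continuous _ a n) cH).
pose T := [set z | canonical_triangle h (H z, L z)].
have cT : convex_plane T.
  apply/convex_planeP => x y Tx Ty t t0 t1; rewrite /T/=.
  have /convex_planeP cc := @canonical_triangle_convex R h.
  have := cc _ _ Tx Ty t t0 t1.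
  by congr canonical_triangle; rewrite /mix/H/L/dotp/=; congr pair; ring.
have sT : convex_hull [set a; b; c] `<=` T.
  apply: convex_hull_min => // z /= [[]|] ->; rewrite /T/canonical_triangle/=.
  - have -> : H a = 0 by rewrite /H; ring.
    have -> : L a = 0 by rewrite /L; ring.
    by rewrite mul0r; split; rewrite ?subr0 ?ler01// ltW.
  - have -> : H b = 0 by rewrite /H/dotp/n/normal/=; ring.
    have -> : L b = 1 by rewrite /L -ab /sqdist; ring.
    by rewrite mul0r; split; rewrite ?subr0 ?ler01// ltW.
  - by rewrite Hc Lc hV; split; lra.
move=> [x y] /= /sT; rewrite /T/=; congr canonical_triangle; congr pair.
  transitivity (sqdist a b * x); last by rewrite ab mul1r.
  by rewrite /H/dotp/n/normal/rigid/sqdist/=; ring.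
transitivity (sqdist a b * y); last by rewrite ab mul1r.
by rewrite /L/dotp/n/normal/rigid/sqdist/=; ring.
Qed.

(** If [c] is on the left of the side from [a] to [b], it is on the right of
the side from [b] to [a]. *)
Lemma area_equilateral (a b c : R * R) :
  sqdist a b = 1 -> sqdist b c = 1 -> sqdist c a = 1 ->
  (area (convex_hull [set a; b; c]) <= (Num.sqrt 3 / 4)%:E)%E.
Proof.
move=> ab bc ca.
have [H0|H0] := lerP 0 (dotp (normal a b) c - dotp (normal a b) a).
  exact: area_equilateral_ge_half.
rewrite (_ : [set a; b; c] = [set b; a; c]); last by rewrite (setUC [set a]).
apply: area_equilateral_ge_half; rewrite 1?sqdistC//.
by move: H0; rewrite /dotp/normal/=; lra.
Qed.

End Diameter.

(** * Sets of constant width *)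

Section Width.
Variable R : realType.
Implicit Types (u p q x y z w : R * R) (A K P V : set (R * R)).

Lemma interior_box A z : interior A z -> exists2 r : R, 0 < r &
  forall a b, `|a| < r -> `|b| < r -> A (z.1 + a, z.2 + b).
Proof.
move/nbhs_ballP => [r /= r0 rA]; exists r => // a b ha hb; apply: rA.
rewrite /ball/=/prod_ball/= /ball/=.
by split; rewrite opprD addrA subrr sub0r normrN.
Qed.

Lemma interior_translate A z u : interior A z -> dotp u u = 1 ->
  exists2 e : R, 0 < e & A (z.1 + e * u.1, z.2 + e * u.2).
Proof.
move=> /interior_box [r r0 rA] u1; exists (r / 2); first by lra.
have h (a b : R) : a * a + b * b = 1 -> `|r / 2 * a| < r.
  move=> ab; have a1 : `|a| <= 1.
    rewrite -(@ler_pXn2r R 2) ?nnegrE// expr1n real_normK ?num_real//; nra.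
  by rewrite normrM ger0_norm; [nra|lra].
by apply: rA; [apply: (h _ u.2) | apply: (h _ u.1)]; move: u1; rewrite /dotp; lra.
Qed.

(** The distance is at least [|h - k|] by the Cauchy-Schwarz inequality, with
equality along the common normal. *)
Lemma set_dist_line u (h k : R) : dotp u u = 1 ->
  set_dist (line u h) (line u k) = `|h - k|.
Proof.
move=> u1; set S := [set eucl_dist x y | x in line u h & y in line u k].
have on_line (m : R) : line u m (m * u.1, m * u.2).
  by rewrite /line/= -[RHS]mulr1 -u1 /dotp/=; ring.
have Shk : S `|h - k|.
  exists (h * u.1, h * u.2) => //; exists (k * u.1, k * u.2) => //.
  rewrite /eucl_dist/= -sqrtr_sqr; congr Num.sqrt.
  by rewrite -[RHS]mulr1 -u1 /dotp; ring.
have lS : lbound S `|h - k|.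
  move=> _ [x hx [y hy <-]].
  rewrite /eucl_dist -sqrtr_sqr; apply: ler_wsqrtr.
  rewrite -hx -hy; move: u1; rewrite /dotp.
  move: (x.1) (x.2) (y.1) (y.2) (u.1) (u.2) => x1 x2 y1 y2 a b ab.
  rewrite -subr_ge0.
  have -> : (x1 - y1) ^+ 2 + (x2 - y2) ^+ 2 - (a * x1 + b * x2 - (a * y1 + b * y2)) ^+ 2
    = (a * (x2 - y2) - b * (x1 - y1)) ^+ 2 +
      (1 - (a * a + b * b)) * ((x1 - y1) ^+ 2 + (x2 - y2) ^+ 2) by ring.
  by rewrite ab subrr mul0r addr0 sqr_ge0.
apply/eqP; rewrite eq_le; apply/andP; split.
  by apply: ge_inf => //; exists `|h - k|.
by apply: lb_le_inf => //; exists `|h - k|.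
Qed.

Lemma line_inj u (h k : R) : dotp u u = 1 -> line u h = line u k -> h = k.
Proof.
move=> u1 hk; have : line u k (h * u.1, h * u.2).
  by rewrite -hk /line/= -[RHS]mulr1 -u1 /dotp/=; ring.
by rewrite /line/= /dotp/= => <-; rewrite -[LHS]mulr1 -u1 /dotp; ring.
Qed.

Lemma dotp_continuous u : continuous (dotp u).
Proof.
move=> z; apply: cvgD; apply: cvgM;
  solve [exact: cvg_cst | exact: cvg_fst | exact: cvg_snd].
Qed.

(** A compact set has two extreme points in the direction [u]; the lines
through them are distinct because [P] has interior points, so constant width
applies to them. *)
Lemma width_attained P u : convex_body P -> constant_width 1 P -> dotp u u = 1 ->
  exists x y, [/\ P x, P y,
    forall z, P z -> dotp u y <= dotp u z <= dotp u x &
    dotp u x - dotp u y = 1].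
Proof.
move=> [cP _ [z0 iz0]] wP u1.
have P0 : P !=set0 by exists z0; exact: interior_subset.
have cu : {within P, continuous (dotp u)}.
  by apply: continuous_subspaceT; exact: dotp_continuous.
have [x xP xmax] := compact_EVT_max P0 cP cu.
have [y yP ymin] := compact_EVT_min P0 cP cu.
rewrite !inE in xP yP.
have bnd z : P z -> dotp u y <= dotp u z <= dotp u x.
  by move=> Pz; rewrite xmax ?ymin ?inE.
exists x, y; split => //.
have lxy : dotp u y < dotp u x.
  have [e e0 Pe] := interior_translate iz0 u1.
  have /andP[_ h1] := bnd _ Pe; have /andP[h2 _] := bnd _ (interior_subset iz0).
  apply: (le_lt_trans h2); apply: lt_le_trans h1.
  rewrite -subr_gt0 (_ : _ - _ = e * dotp u u); first by rewrite u1 mulr1.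
  by rewrite /dotp/=; ring.
have := wP u (dotp u x) (dotp u y) u1; rewrite set_dist_line//.
rewrite ger0_norm; last by rewrite subr_ge0 ltW.
apply.
- by split; [exists x | left => z /bnd /andP[]].
- by split; [exists y | right => z /bnd /andP[]].
- by move/(line_inj u1) => h; move: lxy; rewrite h ltxx.
Qed.

(** Two points are at most as far apart as the width in their own direction. *)
Lemma constant_width_diam P : convex_body P -> constant_width 1 P ->
  forall x y, P x -> P y -> sqdist x y <= 1.
Proof.
move=> bP wP x y Px Py.
have := sqdist_ge0 x y; rewrite le_eqVlt => /predU1P[<-|d0]; first exact: ler01.
pose d := Num.sqrt (sqdist x y).
have dd : d ^+ 2 = sqdist x y by rewrite sqr_sqrtr // ltW.
have d0' : 0 < d by rewrite sqrtr_gt0.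
have dn : d != 0 by rewrite gt_eqF.
pose u : R * R := ((x.1 - y.1) / d, (x.2 - y.2) / d).
have u1 : dotp u u = 1.
  transitivity (sqdist x y / d ^+ 2); first by rewrite /dotp/u/sqdist/=; field.
  by rewrite dd divff// gt_eqF.
have [a [b [_ _ bnd ab]]] := width_attained bP wP u1.
have /andP[_ h1] := bnd _ Px; have /andP[h2 _] := bnd _ Py.
have : dotp u x - dotp u y <= 1 by lra.
rewrite (_ : _ - _ = sqdist x y / d); last by rewrite /dotp/u/sqdist/=; field.
by rewrite -dd expr2 mulfK// => d1; rewrite -[1]mulr1; apply: ler_pM => //; exact: ltW.
Qed.

Lemma max_boundary P u x : dotp u u = 1 -> P x ->
  (forall z, P z -> dotp u z <= dotp u x) -> boundary P x.
Proof.
move=> u1 Px xmax; split; first exact: subset_closure.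
move=> ix; have [e e0 Pe] := interior_translate ix u1.
have := xmax _ Pe; rewrite -subr_le0 (_ : _ - _ = e * dotp u u).
  by rewrite u1 mulr1 leNgt e0.
by rewrite /dotp/=; ring.
Qed.

(** [pi / 3] and its double are supplementary angles, which gives a quadratic
equation for the cosine. *)
Lemma cos_pi3 : cos (pi / 3) = 1 / 2 :> R.
Proof.
have pi0 : 0 < pi :> R := pi_gt0 R.
have c0 : 0 < cos (pi / 3) :> R.
  by apply: cos_gt0_pihalf; apply/andP; split; lra.
have : cos (pi / 3 *+ 2) = - cos (pi / 3) :> R.
  rewrite (_ : pi / 3 *+ 2 = - (pi / 3) + pi :> R); last by field.
  by rewrite cosDpi cosN.
rewrite cos_mulr2n => h.
have : (cos (pi / 3) - 1 / 2) * (cos (pi / 3) + 1) = 0 :> R by lra.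
by move/eqP; rewrite mulf_eq0 => /orP[|] /eqP; lra.
Qed.

Lemma cos_pi6 : cos (pi / 6) = Num.sqrt 3 / 2 :> R.
Proof.
have pi0 : 0 < pi :> R := pi_gt0 R.
have c0 : 0 < cos (pi / 6) :> R.
  by apply: cos_gt0_pihalf; apply/andP; split; lra.
have := cos_pi3; rewrite (_ : pi / 3 = pi / 6 *+ 2 :> R); last by field.
rewrite cos_mulr2n => h.
have s3 : Num.sqrt 3 ^+ 2 = 3 :> R by rewrite sqr_sqrtr.
have s30 : 0 < Num.sqrt 3 :> R by rewrite sqrtr_gt0.
have : (cos (pi / 6) - Num.sqrt 3 / 2) * (cos (pi / 6) + Num.sqrt 3 / 2) = 0 :> R.
  by rewrite -subr_sqr expr_div_n s3; lra.
by move/eqP; rewrite mulf_eq0 => /orP[|] /eqP; lra.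
Qed.

Lemma sqdist_chord c (a b : R) :
  sqdist (unit_circle_point c a) (unit_circle_point c b) = 2 - 2 * cos (a - b).
Proof.
have := cos2Dsin2 a; have := cos2Dsin2 b.
by rewrite cosB /sqdist/unit_circle_point/=; lra.
Qed.

Lemma sqdist_center c (a : R) : sqdist c (unit_circle_point c a) = 1.
Proof. by rewrite -(cos2Dsin2 a) /sqdist/unit_circle_point/=; ring. Qed.

Lemma le_cos (a b : R) : 0 <= a -> a <= b -> b <= pi -> cos b <= cos a.
Proof.
move=> a0 ab bpi; move: ab; rewrite le_eqVlt => /predU1P[->//|ab].
by apply: ltW; rewrite ltr_cos// in_itv/=; apply/andP; split; lra.
Qed.

(** On a longer arc some chord, taken at angle at most [pi] so that the cosine
is still decreasing, would exceed length [1]. *)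
Lemma arc_angle_le P c (s t : R) : (forall x y, P x -> P y -> sqdist x y <= 1) ->
  unit_arc c s t `<=` P -> s < t -> t - s <= pi / 3.
Proof.
move=> dP arcP st; have pi0 : 0 < pi :> R := pi_gt0 R.
rewrite leNgt; apply/negP => h.
(* Beyond angle [pi] the chord shrinks again, so the arc is cut there. *)
pose t' := Num.min t (s + pi).
have [t't t's] : t' <= t /\ t' <= s + pi by rewrite /t' !ge_min !lexx orbT.
have t'g : s + pi / 3 < t' by rewrite /t' lt_min; apply/andP; split; lra.
have Pt' : P (unit_circle_point c t').
  by apply: arcP; exists t' => //=; rewrite in_itv/=; apply/andP; split; lra.
have Ps : P (unit_circle_point c s).
  by apply: arcP; exists s => //=; rewrite in_itv/= lexx ltW.
have := dP _ _ Pt' Ps; rewrite sqdist_chord.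
have : cos (t' - s) < cos (pi / 3).
  by rewrite ltr_cos ?in_itv/=; [lra | apply/andP; split; lra | apply/andP; split; lra].
by rewrite cos_pi3; lra.
Qed.

(** First-order condition: the derivative of the height along the circle
vanishes, so the radius is parallel to [u]. *)
Lemma arc_interior_max c (s t a : R) u : s < a -> a < t -> dotp u u = 1 ->
  (forall b, s < b -> b < t ->
    dotp u (unit_circle_point c b) <= dotp u (unit_circle_point c a)) ->
  u = (cos a, sin a) \/ u = (- cos a, - sin a).
Proof.
move=> sa at_ u1 amax.
pose f (b : R) := u.1 * cos b + u.2 * sin b.
have df (b : R) : is_derive b 1 f (- u.1 * sin b + u.2 * cos b).
  by apply: is_derive_eq; rewrite /GRing.scale/=; ring.
have fa : is_derive a 1 f 0.
  apply: (@derive1_at_max _ f s t a); first by lra.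
  - by move=> b _; have [] := df b.
  - by rewrite in_itv/= sa.
  - move=> b; rewrite in_itv/= => /andP[sb bt].
    by have := amax _ sb bt; rewrite /f /dotp/unit_circle_point/=; lra.
have e0 : - u.1 * sin a + u.2 * cos a = 0.
  by have [_ <-] := df a; have [_ ->] := fa.
pose l := u.1 * cos a + u.2 * sin a.
have ca := cos2Dsin2 a.
have ul : u = (l * cos a, l * sin a).
  case: (u) e0 @l => u1' u2' /= e0; congr pair.
    transitivity (u1' * (cos a ^+ 2 + sin a ^+ 2)
      + sin a * (- u1' * sin a + u2' * cos a)); first by rewrite ca e0; ring.
    by ring.
  transitivity (u2' * (cos a ^+ 2 + sin a ^+ 2)
      - cos a * (- u1' * sin a + u2' * cos a)); first by rewrite ca e0; ring.
  by ring.
have : l ^+ 2 = 1.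
  transitivity (l ^+ 2 * (cos a ^+ 2 + sin a ^+ 2)); first by rewrite ca mulr1.
  by rewrite -u1 [in RHS]ul /dotp/=; ring.
move/eqP; rewrite sqrf_eq1 => /orP[|] /eqP l1; rewrite ul l1.
  by left; rewrite !mul1r.
by right; rewrite !mulN1r.
Qed.

(** If the extreme point of [P] is inside the arc, the radius through it is [u]
(the opposite direction would put the centre higher than the maximum). The
nearer end of the arc is within angle [pi / 6] of it. *)
Lemma arc_endpoint_high P c (s t a : R) u :
  (forall x y, P x -> P y -> sqdist x y <= 1) -> P c ->
  unit_arc c s t `<=` P -> s < t -> s <= a -> a <= t -> dotp u u = 1 ->
  (forall z, P z -> dotp u z <= dotp u (unit_circle_point c a)) ->
  exists2 w, w = unit_circle_point c s \/ w = unit_circle_point c t &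
    w = unit_circle_point c a \/ Num.sqrt 3 / 2 <= dotp u w - dotp u c.
Proof.
move=> dP Pc arcP st sa at_ u1 amax; have pi0 : 0 < pi :> R := pi_gt0 R.
move: sa; rewrite le_eqVlt => /predU1P[<-|sa].
  by exists (unit_circle_point c s); left.
move: at_; rewrite le_eqVlt => /predU1P[->|at_].
  by exists (unit_circle_point c t); [right|left].
have bmax b : s < b -> b < t ->
    dotp u (unit_circle_point c b) <= dotp u (unit_circle_point c a).
  by move=> sb bt; apply/amax/arcP; exists b => //=; rewrite in_itv/= !ltW.
have ca := cos2Dsin2 a.
have [uE|uE] := arc_interior_max sa at_ u1 bmax; last first.
  have := amax _ Pc; rewrite uE /dotp/unit_circle_point/=; lra.
have st3 := arc_angle_le dP arcP st.
have hgt b : dotp u (unit_circle_point c b) - dotp u c = cos (a - b).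
  by rewrite cosB uE /dotp/unit_circle_point/=; ring.
have [h|h] := lerP (a - s) (pi / 6).
  exists (unit_circle_point c s); first by left.
  by right; rewrite hgt -cos_pi6; apply: le_cos; lra.
exists (unit_circle_point c t); first by right.
right; rewrite hgt -cos_pi6 -[X in _ <= X]cosN opprB; apply: le_cos; lra.
Qed.

End Width.

(** * Skeletons of Reuleaux polygons *)

Section ReuleauxPolygon.
Variable R : realType.
Implicit Types (u p q x y z w : R * R) (A K P V : set (R * R)).

Section Vertices.
Variables (P V : set (R * R)) (n : nat) (v c : 'I_n -> R * R) (s t : 'I_n -> R).
Hypotheses (bP : convex_body P) (wP : constant_width 1 P).
Hypotheses (aP : arc_boundary P v c s t) (VE : V = range v).
Hypothesis Vc : forall i, V (c i).

Let dP := constant_width_diam bP wP.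

Lemma boundary_sub : boundary P `<=` P.
Proof.
have [cP _ _] := bP.
move=> x [clx _]; move: clx; rewrite -(closure_id _).1//.
exact: compact_closed (@plane_hausdorff R) cP.
Qed.

Lemma arc_sub i : unit_arc (c i) (s i) (t i) `<=` P.
Proof.
have [_ _ _ _ bE] := aP.
by move=> x ax; apply: boundary_sub; rewrite bE; exists i.
Qed.

Lemma arc_ends i : s i < t i /\
  V (unit_circle_point (c i) (s i)) /\ V (unit_circle_point (c i) (t i)).
Proof.
have [_ st vE _ _] := aP; have /andP[sti _] := st i; have [<- <-] := vE i.
by split => //; rewrite VE; split; [exists i | exists (ordS i)].
Qed.

Lemma vertex_sub : V `<=` P.
Proof.
have [_ st vE _ _] := aP.
rewrite VE => _ [i _ <-]; have [-> _] := vE i; apply: (@arc_sub i).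
by have /andP[sti _] := st i; exists (s i) => //=; rewrite in_itv/= lexx ltW.
Qed.

(** An extreme point of [P] is on the boundary, hence on an arc, where
[arc_endpoint_high] applies. *)
Lemma max_vertex u x : dotp u u = 1 -> P x ->
  (forall z, P z -> dotp u z <= dotp u x) ->
  V x \/ exists w w', [/\ V w, V w' & Num.sqrt 3 / 2 <= dotp u w - dotp u w'].
Proof.
move=> u1 Px xmax; have [_ _ _ _ bE] := aP.
have := max_boundary u1 Px xmax; rewrite bE => -[i _ [a]].
rewrite /= in_itv/= => /andP[sa at_] xE.
have [sti [Vs Vt]] := arc_ends i.
have amax z : P z -> dotp u z <= dotp u (unit_circle_point (c i) a).
  by rewrite xE; exact: xmax.
have [w ww [wx|wh]] := arc_endpoint_high dP (vertex_sub (Vc i)) (@arc_sub i)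
  sti sa at_ u1 amax.
  by left; rewrite -xE -wx; case: ww => ->.
by right; exists w, (c i); split => //; case: ww => ->.
Qed.

(** If both extreme points of [P] are vertices the breadth is [1]; otherwise
[max_vertex] supplies the two vertices. *)
Lemma vertices_breadth u : dotp u u = 1 ->
  exists w w', [/\ V w, V w' & Num.sqrt 3 / 2 <= dotp u w - dotp u w'].
Proof.
move=> u1; have [x [y [Px Py bnd xy]]] := width_attained bP wP u1.
have s32 : Num.sqrt 3 / 2 <= 1 :> R.
  have s3 : Num.sqrt 3 ^+ 2 = 3 :> R by rewrite sqr_sqrtr.
  have s30 : 0 <= Num.sqrt 3 :> R by exact: sqrtr_ge0.
  nra.
pose u' : R * R := (- u.1, - u.2).
have uN z : dotp u' z = - dotp u z by rewrite /dotp/u'/=; ring.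
have u'1 : dotp u' u' = 1 by rewrite -u1 /dotp/u'/=; ring.
have xmax z : P z -> dotp u z <= dotp u x by move=> /bnd /andP[].
have ymax z : P z -> dotp u' z <= dotp u' y.
  by rewrite !uN lerN2 => /bnd /andP[].
have [Vx|] := max_vertex u1 Px xmax; last by [].
have [Vy|[w [w' [Vw Vw' h]]]] := max_vertex u'1 Py ymax.
  by exists x, y; split => //; rewrite xy.
by exists w', w; split => //; move: h; rewrite !uN; lra.
Qed.

Lemma area_skeleton_ge : (0 < n)%N -> ((Num.sqrt 3 / 4)%:E <= area (skeleton V))%E.
Proof.
move=> n0; pose i0 := Ordinal n0.
have finV : finite_set V by rewrite VE; exact: finite_image.
have [_ [Vs _]] := arc_ends i0.
set p := c i0; set q := unit_circle_point (c i0) (s i0) in Vs.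
have pq1 : sqdist p q = 1 by exact: sqdist_center.
have n1 : dotp (normal p q) (normal p q) = 1 by rewrite dotp_normal.
have [w [w' [Vw Vw' h]]] := vertices_breadth n1.
have sV : V `<=` convex_hull V by exact: sub_convex_hull.
have := area_ge_half_breadth (finite_convex_hull_closed finV)
  (@convex_convex_hull R V) (sV _ (Vc i0)) (sV _ Vs) (sV _ Vw) (sV _ Vw') pq1.
by apply: le_trans; rewrite lee_fin; lra.
Qed.

Lemma unit_circle_point_inj (z : R * R) (a b : R) : `|a - b| <= pi ->
  unit_circle_point z a = unit_circle_point z b -> a = b.
Proof.
move=> ab h; have pi0 : 0 < pi :> R := pi_gt0 R.
have := sqdist_chord z a b; rewrite h /sqdist !subrr expr0n/= addr0 => h2.
have c1 : cos `|a - b| = cos 0 by rewrite cos_norm cos0; lra.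
have : `|a - b| = 0.
  have nn := normr_ge0 (a - b).
  by apply: cos_inj c1; rewrite in_itv/=; apply/andP; split; lra.
by move/eqP; rewrite normr_eq0 subr_eq0 => /eqP.
Qed.

(** The arc is an injective image of an interval of positive length, and a
finite set has measure zero. *)
Lemma arc_point_not_vertex i :
  exists2 a, s i <= a <= t i & ~ V (unit_circle_point (c i) a).
Proof.
have [sti _] := arc_ends i.
have pi0 : 0 < pi :> R := pi_gt0 R.
have st3 := arc_angle_le dP (@arc_sub i) sti.
have finV : finite_set V by rewrite VE; exact: finite_image.
apply: contrapT => h.
have sub a : s i <= a <= t i -> V (unit_circle_point (c i) a).
  by move=> sat; apply: contrapT => na; apply: h; exists a.
have inj : {in `[s i, t i]%classic &, injective (unit_circle_point (c i))}.
  move=> a b; rewrite !inE/= !in_itv/= => /andP[? ?] /andP[? ?].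
  by apply: unit_circle_point_inj; rewrite ler_norml; apply/andP; split; lra.
have fI : finite_set `[s i, t i]%classic.
  rewrite -(eq_finite_set (inj_card_eq inj)).
  by apply: sub_finite_set finV => _ [a /= + <-]; rewrite in_itv/=; exact: sub.
have := countable_lebesgue_measure0 (finite_set_countable fI).
rewrite lebesgue_measure_itv/= lte_fin sti -EFinB => -[]; lra.
Qed.

(** The disk minus one point [m] of its boundary circle is still convex, since
[m] is an extreme point. *)
Lemma extreme_point_not_hull z m : sqdist z m = 1 ->
  (forall x, V x -> sqdist z x <= 1) -> ~ V m -> ~ convex_hull V m.
Proof.
move=> m1 Vz Vm hm.
pose A := [set x | sqdist z x <= 1 /\ x <> m].
suff [] : A m by [].
apply: (convex_hull_min _ _ hm); last first.
  by move=> x Vx; split; [exact: Vz|move=> xm; apply: Vm; rewrite -xm].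
pose al x := (m.1 - z.1) * (x.1 - z.1) + (m.2 - z.2) * (x.2 - z.2).
have al_lt x : A x -> al x < 1.
  move=> [x1 xm].
  have E : sqdist x m = sqdist z x + sqdist z m - 2 * al x by rewrite /sqdist/al; ring.
  have : 0 < sqdist x m.
    rewrite lt_neqAle sqdist_ge0 andbT eq_sym; apply/eqP => d0; apply: xm.
    move: d0 => /eqP; rewrite /sqdist paddr_eq0 ?sqr_ge0// !sqrf_eq0 !subr_eq0.
    by case: (x) (m) => a b [a' b'] /= /andP[/eqP -> /eqP ->].
  by rewrite E m1; lra.
apply/convex_planeP => x y Ax Ay t0 t00 t01; split.
  by case: Ax Ay => [x1 _] [y1 _]; exact: sqdist_mix_le.
move=> mE; have := al_lt _ Ax; have := al_lt _ Ay.
have : al (mix t0 x y) = 1 by rewrite mE -m1 /al /sqdist; ring.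
rewrite (_ : al (mix t0 x y) = t0 * al x + (1 - t0) * al y); last by rewrite /al/mix/=; ring.
move: (al x) (al y) => ax ay h ay1 ax1.
have := mulr_ge0 t00 (ltW (_ : 0 < 1 - ax)); rewrite subr_gt0 => /(_ ax1) h1.
have h2 : 0 <= (1 - t0) * (1 - ay) by rewrite mulr_ge0// subr_ge0// ltW.
by have [t1|t1] := lerP t0 (1 / 2); nra.
Qed.

(** The square [D] is found in the image of a box around an interior point of
[P] under a contraction towards a point [m] of [P] outside of the skeleton; the
ratio [k] is small enough for the image to stay near [m]. *)
Lemma area_skeleton_lt : (0 < n)%N -> (area (skeleton V) < (pi / 4)%:E)%E.
Proof.
move=> n0; pose i0 := Ordinal n0.
have finV : finite_set V by rewrite VE; exact: finite_image.
have clH := finite_convex_hull_closed finV.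
have [_ /[dup] vP /convex_planeP cvP [z0 iz0]] := bP.
have [a sat nVm] := arc_point_not_vertex i0.
set m := unit_circle_point (c i0) a in nVm.
have Pm : P m by apply: (@arc_sub i0); exists a => //=; rewrite in_itv.
have nHm : ~ convex_hull V m.
  apply: (extreme_point_not_hull (sqdist_center (c i0) a)) => // x Vx.
  by apply: dP; [exact/vertex_sub/Vc | exact: vertex_sub].
have [r r0 rH] : exists2 r : R, 0 < r & forall a b, `|a| < r -> `|b| < r ->
    (~` convex_hull V) (m.1 + a, m.2 + b).
  by apply: interior_box; apply: open_nbhs_nbhs; split => //; exact: closed_openC.
have [r' r'0 rP] := interior_box iz0.
pose B := `|z0.1 - m.1| + `|z0.2 - m.2| + r'.
have [n1 n2] : 0 <= `|z0.1 - m.1| /\ 0 <= `|z0.2 - m.2| by [].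
have B0 : 0 < B by rewrite /B; lra.
(* With this ratio [k * B < r], where [B] bounds the distance in each
   coordinate from [m] to the points of the box. *)
pose k := r / (r + B).
have rB0 : 0 < r + B by lra.
have k0 : 0 < k by exact: divr_gt0.
have k1 : k <= 1 by rewrite ler_pdivrMr// mul1r; lra.
have kB : k * B < r by rewrite /k mulrAC ltr_pdivrMr//; nra.
have kn : k != 0 by rewrite gt_eqF.
pose w := mix k z0 m.
pose rho := k * r' / 2.
have rho0 : 0 < rho by rewrite /rho; nra.
pose D : set (R * R) := `[(w.1 - rho), (w.1 + rho)]%classic `*`
  `[(w.2 - rho), (w.2 + rho)]%classic.
have mD : plane_measurable D by apply: measurableX; exact: measurable_itv.
have mH : plane_measurable (convex_hull V) by exact: closed_plane_measurable.
have near_w (z1 w1 m1 z01 : R) : w1 = k * z01 + (1 - k) * m1 ->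
    w1 - rho <= z1 -> z1 <= w1 + rho ->
    `|(z1 - w1) / k| < r' /\ (`|z01 - m1| + r' <= B -> `|z1 - m1| < r).
  move=> wE h1 h2.
  have zw : `|z1 - w1| <= rho by rewrite ler_norml; apply/andP; split; lra.
  split.
    rewrite normrM normfV (gtr0_norm k0) ltr_pdivrMr//; apply: (le_lt_trans zw).
    by rewrite /rho mulrC; have := mulr_gt0 k0 r'0; lra.
  move=> hB; have -> : z1 - m1 = (z1 - w1) + k * (z01 - m1) by rewrite wE; ring.
  apply: le_lt_trans (ler_normD _ _) _.
  rewrite normrM (gtr0_norm k0).
  have : k * (`|z01 - m1| + r') <= k * B by rewrite ler_pM2l.
  by move: kB rho0 zw; rewrite /rho; lra.
have DP : D `<=` P.
  move=> z [] /=; rewrite !in_itv/= => /andP[h1 h2] /andP[h3 h4].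
  have [e1 _] := near_w z.1 w.1 m.1 z0.1 erefl h1 h2.
  have [e2 _] := near_w z.2 w.2 m.2 z0.2 erefl h3 h4.
  have := cvP _ _ (rP _ _ e1 e2) Pm k (ltW k0) k1.
  rewrite (_ : mix k _ _ = z)// /mix/w/mix/=; case: (z) => z1 z2 /=.
  by congr pair; field.
have DH : convex_hull V `&` D = set0.
  rewrite -subset0 => z [Hz []] /=; rewrite !in_itv/= => /andP[h1 h2] /andP[h3 h4].
  have [_ e1] := near_w z.1 w.1 m.1 z0.1 erefl h1 h2.
  have [_ e2] := near_w z.2 w.2 m.2 z0.2 erefl h3 h4.
  apply: (rH (z.1 - m.1) (z.2 - m.2)).
  - by apply: e1; rewrite /B lerD2r lerDl.
  - by apply: e2; rewrite /B lerD2r lerDr.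
  - rewrite (_ : (_, _) = z)// [RHS]surjective_pairing; congr pair; exact: subrKC.
have mU : plane_measurable (convex_hull V `|` D) by exact: measurableU.
have HP : convex_hull V `<=` P by apply: convex_hull_min => //; exact: vertex_sub.
have UP : convex_hull V `|` D `<=` P by move=> z [/HP|/DP].
have iso : (area (convex_hull V `|` D) <= (pi / 4)%:E)%E.
  by apply: isodiametric => // x y /UP Px /UP Py; exact: dP.
have areaD : area D = ((2 * rho) * (2 * rho))%:E.
  have len (x : R) : lebesgue_measure `[(x - rho), (x + rho)]%classic = (2 * rho)%:E.
    rewrite lebesgue_measure_itv/= lte_fin ifT; last by lra.
    by rewrite -EFinB; congr EFin; ring.
  rewrite /area product_measure1E; [|exact: measurable_itv|exact: measurable_itv].
  by rewrite EFinM; congr (_ * _)%E; exact: len.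
have areaU : area (convex_hull V `|` D) = (area (convex_hull V) + area D)%E.
  exact: (@measureU _ _ _ (lebesgue_measure \x lebesgue_measure)%E).
rewrite /skeleton; move: iso; rewrite areaU areaD.
case: (area _) => [h| |].
- by rewrite -EFinD !lee_fin lte_fin; nra.
- by [].
- by rewrite ltNyr.
Qed.

End Vertices.
End ReuleauxPolygon.

(** * The Reuleaux triangle has constant width *)

Section ReuleauxTriangle.
Variable R : realType.
Implicit Types (a b c p q r u x y z w : R * R).

Definition equilateral a b c : Prop :=
  [/\ sqdist a b = 1, sqdist b c = 1 & sqdist c a = 1].

Lemma equilateral_rot a b c : equilateral a b c -> equilateral b c a.
Proof. by case. Qed.

Lemma reuleaux_triangle_rot a b c : reuleaux_triangle a b c = reuleaux_triangle b c a.
Proof. by apply/seteqP; split => x []. Qed.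

Lemma reuleaux_triangleE a b c : reuleaux_triangle a b c =
  [set x | [/\ sqdist a x <= 1, sqdist b x <= 1 & sqdist c x <= 1]].
Proof. by apply/seteqP; split => x; rewrite /reuleaux_triangle/= !eucl_dist_le1. Qed.

Lemma sqdist_continuous a : continuous (sqdist a).
Proof.
have h (f : R * R -> R) (k : R) : continuous f -> continuous (fun z => (k - f z) ^+ 2).
  move=> cf z; apply: (@continuous_comp _ _ _ (fun z => k - f z) (fun t : R => t ^+ 2)).
    by apply: cvgB; [exact: cvg_cst|exact: cf].
  exact: exprn_continuous.
move=> z; apply: cvgD; first exact: (h _ _ (@fst_continuous R)).
exact: (h _ _ (@snd_continuous R)).
Qed.

Lemma disk_closed a : closed [set x | sqdist a x <= 1].
Proof.
rewrite (_ : mkset _ = sqdist a @^-1` [set t | t <= 1])//.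
by apply: preimage_closed; [move=> z _; exact: sqdist_continuous | exact: closed_le].
Qed.

Lemma disk_interior a x : sqdist a x < 1 -> nbhs x [set z | sqdist a z < 1].
Proof.
move=> ax; apply: open_nbhs_nbhs; split => //.
rewrite (_ : mkset _ = sqdist a @^-1` [set t | t < 1])//.
by apply: open_comp; [move=> z _; exact: sqdist_continuous | exact: open_lt].
Qed.

Section Equilateral.
Variables a b c : R * R.
Hypothesis abc : equilateral a b c.
Let T := reuleaux_triangle a b c.

Lemma reuleaux_triangle_vertex : [/\ T a, T b & T c].
Proof.
have [ab bc ca] := abc; have [ba cb ac] := And3 ab bc ca.
rewrite sqdistC in ba; rewrite sqdistC in cb; rewrite sqdistC in ac.
have d0 x : sqdist x x = 0 by rewrite /sqdist !subrr expr0n/= addr0.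
by rewrite /T reuleaux_triangleE; split; split; rewrite ?d0 ?ab ?bc ?ca ?ba ?cb ?ac.
Qed.

Lemma reuleaux_triangle_convex : convex_plane T.
Proof.
rewrite /T reuleaux_triangleE; apply/convex_planeP => x y [? ? ?] [? ? ?] t t0 t1.
by split; exact: sqdist_mix_le.
Qed.

Lemma reuleaux_triangle_closed : closed T.
Proof.
rewrite /T reuleaux_triangleE.
rewrite (_ : mkset _ = [set x | sqdist a x <= 1] `&` [set x | sqdist b x <= 1] `&`
  [set x | sqdist c x <= 1]).
  by do 2 (apply: closedI; last exact: disk_closed); exact: disk_closed.
by apply/seteqP; split => x /=; [case|case=> -[]].
Qed.

Lemma reuleaux_triangle_compact : compact T.
Proof.
apply: (@subclosed_compact _ _
  (`[(a.1 - 1), (a.1 + 1)]%classic `*` `[(a.2 - 1), (a.2 + 1)]%classic)).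
- exact: reuleaux_triangle_closed.
- by apply: compact_setX; exact: segment_compact.
- move=> x; rewrite /T reuleaux_triangleE => -[ax _ _].
  have bnd (t t' : R) : t ^+ 2 + t' ^+ 2 <= 1 -> -1 <= t /\ t <= 1.
    by move=> tt; have := sqr_ge0 t'; split; nra.
  have [h1 h2] := bnd _ _ ax; rewrite /sqdist addrC in ax; have [h3 h4] := bnd _ _ ax.
  by split; rewrite /= in_itv/=; apply/andP; split; lra.
Qed.

Lemma reuleaux_triangle_interior x : sqdist a x < 1 -> sqdist b x < 1 ->
  sqdist c x < 1 -> interior T x.
Proof.
move=> ax bx cx; rewrite /T reuleaux_triangleE.
apply: filterS (filterI (filterI (disk_interior ax) (disk_interior bx)) (disk_interior cx)).
by move=> z [[/= ? ?] ?]; split; exact: ltW.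
Qed.

Lemma reuleaux_triangle_body : convex_body T.
Proof.
split; [exact: reuleaux_triangle_compact|exact: reuleaux_triangle_convex|].
pose g : R * R := ((a.1 + b.1 + c.1) / 3, (a.2 + b.2 + c.2) / 3).
have centroid p q r : sqdist p q = 1 -> sqdist q r = 1 -> sqdist r p = 1 ->
    sqdist p ((p.1 + q.1 + r.1) / 3, (p.2 + q.2 + r.2) / 3) < 1.
  move=> pq qr rp.
  rewrite (_ : sqdist _ _ = (2 * sqdist p q + 2 * sqdist r p - sqdist q r) / 9).
    by rewrite pq qr rp; lra.
  by rewrite /sqdist/=; field.
have [ab bc ca] := abc; exists g; apply: reuleaux_triangle_interior.
- exact: centroid.
- rewrite (_ : g = ((b.1 + c.1 + a.1) / 3, (b.2 + c.2 + a.2) / 3)).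
    exact: centroid.
  by rewrite /g; congr pair; field.
- rewrite (_ : g = ((c.1 + a.1 + b.1) / 3, (c.2 + a.2 + b.2) / 3)).
    exact: centroid.
  by rewrite /g; congr pair; field.
Qed.

(** Moving away from [a] increases the distance to [a] beyond [1]. *)
Lemma not_interior x : sqdist a x = 1 -> ~ interior T x.
Proof.
move=> ax ix; pose u : R * R := (x.1 - a.1, x.2 - a.2).
have u1 : dotp u u = 1 by rewrite -ax /dotp/u/sqdist/=; ring.
have [e e0] := interior_translate ix u1.
rewrite /T reuleaux_triangleE => -[+ _ _].
rewrite (_ : sqdist a _ = (1 + e) ^+ 2 * sqdist a x).
  by rewrite ax; nra.
by rewrite /sqdist/u/=; ring.
Qed.

(** The set has exact breadth [1] in the direction [u], and both extreme
heights are attained. *)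
Definition unit_breadth (A : set (R * R)) u := exists x y,
  [/\ A x, A y, forall z, A z -> dotp u y <= dotp u z <= dotp u x &
      dotp u x - dotp u y = 1].

Lemma unit_breadthN A u : unit_breadth A (- u.1, - u.2) -> unit_breadth A u.
Proof.
have uN z : dotp (- u.1, - u.2) z = - dotp u z by rewrite /dotp/=; ring.
move=> [x [y [Ax Ay bnd xy]]]; exists y, x; split=> // [z /bnd|].
  by rewrite !uN !lerN2 andbC.
by move: xy; rewrite !uN; lra.
Qed.

(** If [u] lies in the angle at [c], the extreme points are [c] and [c + u].
The point [c + u] is in the triangle because [u] makes an angle at most [pi /
3] with both sides; the heights over [c] are nonnegative since the disks around
[a] and [b], whose circles pass through [c], lie on the positive side of it in
the directions of [a] and [b]. *)
Lemma unit_breadth_cone u (l m : R) : dotp u u = 1 -> 0 <= l -> 0 <= m ->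
  u = (l * (a.1 - c.1) + m * (b.1 - c.1), l * (a.2 - c.2) + m * (b.2 - c.2)) ->
  unit_breadth T u.
Proof.
have [ab bc ca] := abc; have [_ _ Tc] := reuleaux_triangle_vertex.
move=> u1 l0 m0 uE.
(* The sides at [c] are unit vectors with inner product [1 / 2]. *)
have lm : l ^+ 2 + m ^+ 2 + l * m = 1.
  rewrite -u1 uE.
  transitivity (l ^+ 2 * sqdist c a + m ^+ 2 * sqdist b c
      + l * m * (sqdist c a + sqdist b c - sqdist a b)).
    by rewrite ab bc ca; ring.
  by rewrite /dotp/sqdist/=; ring.
have lm1 : l <= 1 /\ m <= 1 by split; nra.
pose x : R * R := (c.1 + u.1, c.2 + u.2).
have Tx : T x.
  rewrite /T reuleaux_triangleE; split.
  - rewrite (_ : sqdist a x = sqdist c a + dotp u u - (2 * l * sqdist c a +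
      m * (sqdist c a + sqdist b c - sqdist a b))).
      rewrite ab bc ca u1; suff : 1 <= 2 * l + m by lra.
      by nra.
    by rewrite /x uE /sqdist/dotp/=; ring.
  - rewrite (_ : sqdist b x = sqdist b c + dotp u u - (2 * m * sqdist b c +
      l * (sqdist c a + sqdist b c - sqdist a b))).
      rewrite ab bc ca u1; suff : 1 <= 2 * m + l by lra.
      by nra.
    by rewrite /x uE /sqdist/dotp/=; ring.
  - have -> : sqdist c x = dotp u u by rewrite /sqdist/dotp/x/=; ring.
    by rewrite u1.
exists x, c; split => // [z|]; last by rewrite -u1 /dotp/x/=; ring.
rewrite /T reuleaux_triangleE => -[az bz cz]; apply/andP; split.
  rewrite -subr_ge0 (_ : _ - _ =
    l * ((sqdist c z + sqdist c a - sqdist a z) / 2) +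
    m * ((sqdist c z + sqdist b c - sqdist b z) / 2)).
    have := sqdist_ge0 c z; rewrite ca bc => cz0.
    by apply: addr_ge0; apply: mulr_ge0 => //; lra.
  by rewrite uE /dotp/sqdist/=; field.
have : (dotp u z - dotp u c) ^+ 2 <= 1.
  apply: le_trans cz; rewrite -subr_ge0.
  rewrite (_ : _ - _ = (u.1 * (z.2 - c.2) - u.2 * (z.1 - c.1)) ^+ 2 +
      (1 - dotp u u) * sqdist c z).
    by rewrite u1 subrr mul0r addr0 sqr_ge0.
  by rewrite /dotp/sqdist; ring.
have -> : dotp u x = dotp u c + 1 by rewrite -u1 /dotp/x/=; ring.
by move: (dotp u z) (dotp u c) => k k' h; nra.
Qed.

Definition cross u w : R := u.1 * w.2 - u.2 * w.1.

(** The cross products of [u] with the sides at [c] are, up to a common factor,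
its coordinates in the basis formed by these sides. Equal signs mean that [u]
or its opposite is in the angle at [c]. *)
Lemma unit_breadth_cross u : dotp u u = 1 ->
  0 <= cross u (c.1 - b.1, c.2 - b.2) * cross u (a.1 - c.1, a.2 - c.2) ->
  unit_breadth T u.
Proof.
move=> u1; have [ab bc ca] := abc.
set e2 : R * R := (c.1 - b.1, c.2 - b.2); set e3 : R * R := (a.1 - c.1, a.2 - c.2).
pose D := cross e2 e3.
(* Lagrange's identity. *)
have D2 : D ^+ 2 = 3 / 4.
  rewrite (_ : D ^+ 2 = sqdist b c * sqdist c a -
    ((sqdist b c + sqdist c a - sqdist a b) / 2) ^+ 2).
    by rewrite ab bc ca; field.
  by rewrite /D/cross/e2/e3/sqdist/=; field.
have D0 : D != 0 by rewrite -sqrf_eq0 D2; apply/eqP; lra.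
set be := cross u e2; set ga := cross u e3 => bg.
pose l := - (be / D); pose m := - (ga / D).
have uE : u = (l * (a.1 - c.1) + m * (b.1 - c.1), l * (a.2 - c.2) + m * (b.2 - c.2)).
  rewrite [LHS]surjective_pairing; congr pair.
    have -> : l * (a.1 - c.1) + m * (b.1 - c.1) = (ga * e2.1 - be * e3.1) / D.
      by rewrite /l/m/e2/e3/=; field.
    by apply: (mulIf D0); rewrite divfK// /ga/be/D/cross; ring.
  have -> : l * (a.2 - c.2) + m * (b.2 - c.2) = (ga * e2.2 - be * e3.2) / D.
    by rewrite /l/m/e2/e3/=; field.
  by apply: (mulIf D0); rewrite divfK// /ga/be/D/cross; ring.
have lm : 0 <= l * m.
  rewrite (_ : l * m = be * ga / D ^+ 2); last by rewrite /l/m; field.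
  by apply: divr_ge0 => //; rewrite D2; lra.
have [l0|l0] := ltrP l 0; last first.
  have [m0|m0] := ltrP m 0; last exact: unit_breadth_cone u1 l0 m0 uE.
  have le : l = 0 by nra.
  apply: unit_breadthN; apply: (@unit_breadth_cone _ (- l) (- m)).
  - by rewrite -u1 /dotp/=; ring.
  - by rewrite le oppr0.
  - by lra.
  - by rewrite [in LHS]uE/=; congr pair; ring.
have m0 : m <= 0 by nra.
apply: unit_breadthN; apply: (@unit_breadth_cone _ (- l) (- m)).
- by rewrite -u1 /dotp/=; ring.
- by lra.
- by lra.
- by rewrite [in LHS]uE/=; congr pair; ring.
Qed.

End Equilateral.

(** The cross products of [u] with the three sides of the triangle add up to
[0], so two of them have the same sign, and the angle between these two sides
is the right one. *)
Lemma reuleaux_triangle_breadth a b c u : equilateral a b c -> dotp u u = 1 ->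
  unit_breadth (reuleaux_triangle a b c) u.
Proof.
move=> abc u1.
pose x := cross u (b.1 - a.1, b.2 - a.2).
pose y := cross u (c.1 - b.1, c.2 - b.2).
pose z := cross u (a.1 - c.1, a.2 - c.2).
have xyz : x + y + z = 0 by rewrite /x/y/z/cross/=; ring.
have bca := equilateral_rot abc; have cab := equilateral_rot bca.
have [h|h1] := lerP 0 (y * z); first exact: (unit_breadth_cross abc u1 h).
have [h|h2] := lerP 0 (z * x).
  by rewrite reuleaux_triangle_rot; exact: (unit_breadth_cross bca u1 h).
have [h|h3] := lerP 0 (x * y).
  by rewrite 2!reuleaux_triangle_rot; exact: (unit_breadth_cross cab u1 h).
exfalso; have z_ : z = - (x + y) by lra.
by move: h1 h2 h3; rewrite z_; nra.
Qed.

Lemma constant_width_breadth (A : set (R * R)) :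
  (forall u, dotp u u = 1 -> unit_breadth A u) -> constant_width 1 A.
Proof.
move=> bA u h k u1 sh sk hk; rewrite set_dist_line//.
have [x [y [Ax Ay bnd xy]]] := bA u u1.
have ends m : supporting A u m -> m = dotp u x \/ m = dotp u y.
  move=> [[z [Az]]]; rewrite /line/= => zm [up|dn].
    left; apply/eqP; rewrite eq_le (up x Ax) andbT -zm.
    by have /andP[] := bnd _ Az.
  right; apply/eqP; rewrite eq_le (dn y Ay) /= -zm.
  by have /andP[] := bnd _ Az.
have [hE|hE] := ends _ sh; have [kE|kE] := ends _ sk; subst h k.
- by case: hk.
- by rewrite xy normr1.
- by rewrite distrC xy normr1.
- by case: hk.
Qed.

End ReuleauxTriangle.

(** * The boundary arcs of the Reuleaux triangle *)

Section TriangleArcs.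
Variable R : realType.
Implicit Types (a b c p q r u x y z w : R * R).

(** Polar coordinates measured from the direction [o], with an angle in a
symmetric interval around it. *)
Lemma polar_angle (o x y : R) : x ^+ 2 + y ^+ 2 = 1 ->
  exists d, [/\ - pi <= d, d <= pi, x = cos (o + d) & y = sin (o + d)].
Proof.
move=> xy.
pose X := x * cos o + y * sin o; pose Y := y * cos o - x * sin o.
have co := cos2Dsin2 o.
have XY : X ^+ 2 + Y ^+ 2 = 1.
  transitivity ((x ^+ 2 + y ^+ 2) * (cos o ^+ 2 + sin o ^+ 2)).
    by rewrite /X/Y; ring.
  by rewrite xy co mulr1.
have X1 : -1 <= X <= 1 by have Y20 := sqr_ge0 Y; apply/andP; split; nra.
have acosX : cos (acos X) = X by apply: acosK; rewrite in_itv.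
have sinX : sin (acos X) = `|Y|.
  by rewrite sin_acos// -sqrtr_sqr; congr Num.sqrt; lra.
have pi0 : 0 < pi :> R := pi_gt0 R.
have a0 := acos_ge0 X1; have api := acos_lepi X1.
have xE : x = X * cos o - Y * sin o.
  transitivity (x * (cos o ^+ 2 + sin o ^+ 2)); first by rewrite co mulr1.
  by rewrite /X/Y; ring.
have yE : y = X * sin o + Y * cos o.
  transitivity (y * (cos o ^+ 2 + sin o ^+ 2)); first by rewrite co mulr1.
  by rewrite /X/Y; ring.
have [Y0|Y0] := lerP 0 Y.
  exists (acos X); rewrite cosD sinD acosX sinX (ger0_norm Y0).
  by split; [lra|lra|rewrite {1}xE; ring|rewrite {1}yE; ring].
exists (- acos X); rewrite cosD sinD cosN sinN acosX sinX (ltr0_norm Y0).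
by split; [lra|lra|rewrite {1}xE; ring|rewrite {1}yE; ring].
Qed.

Lemma cos_half_le (d : R) : d <= pi -> 1 / 2 <= cos (d + pi / 6) -> d <= pi / 6.
Proof.
move=> dpi; have pi0 : 0 < pi :> R := pi_gt0 R.
apply: contraTT; rewrite -!ltNge => h.
have [d6|d6] := lerP (d + pi / 6) pi.
  by rewrite -cos_pi3 ltr_cos ?in_itv/=;
    [lra | apply/andP; split; lra | apply/andP; split; lra].
rewrite (_ : d + pi / 6 = (d + pi / 6 - pi) + pi); last by ring.
rewrite cosDpi; have : 0 < cos (d + pi / 6 - pi).
  by apply: cos_gt0_pihalf; apply/andP; split; lra.
by lra.
Qed.

(** Seen from [p] and measured from the bisector [f + pi / 6], the distance
conditions to the two other vertices bound the angle by [pi / 6] on either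
side. *)
Lemma reuleaux_arc p (f : R) x :
  [/\ sqdist p x = 1, sqdist (unit_circle_point p f) x <= 1 &
      sqdist (unit_circle_point p (f + pi / 3)) x <= 1] <->
  unit_arc p f (f + pi / 3) x.
Proof.
have pi0 : 0 < pi :> R := pi_gt0 R.
split=> [[px qx rx]|[h /= + <-]]; last first.
  rewrite in_itv/= => /andP[fh hf].
  rewrite sqdist_center !sqdist_chord; split => //.
    have : cos (pi / 3) <= cos (h - f) by apply: le_cos; lra.
    by rewrite -(cosN (f - h)) opprB cos_pi3; lra.
  have : cos (pi / 3) <= cos (f + pi / 3 - h) by apply: le_cos; lra.
  by rewrite cos_pi3; lra.
have px' : (x.1 - p.1) ^+ 2 + (x.2 - p.2) ^+ 2 = 1.
  by rewrite -px /sqdist; ring.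
have [d [d1 d2 x1 x2]] := polar_angle (f + pi / 6) px'.
have xE : x = unit_circle_point p (f + pi / 6 + d).
  by rewrite /unit_circle_point -x1 -x2 [LHS]surjective_pairing; congr pair; ring.
move: qx rx; rewrite xE !sqdist_chord.
rewrite (_ : f - _ = - (d + pi / 6)); last by ring.
rewrite (_ : f + pi / 3 - _ = - d + pi / 6); last by field.
rewrite cosN => h1 h2.
have du : d <= pi / 6 by apply: cos_half_le => //; lra.
have dl : - d <= pi / 6 by apply: cos_half_le; lra.
by exists (f + pi / 6 + d) => //=; rewrite in_itv/=; apply/andP; split; lra.
Qed.

(** The parameter [f] is the direction from [p] to [q], and [r] is reached by a
further sixth of a turn. *)
Definition ccw_triangle p q r (f : R) : Prop :=
  q = unit_circle_point p f /\ r = unit_circle_point p (f + pi / 3).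

Lemma sin_pi3 : sin (pi / 3) = Num.sqrt 3 / 2 :> R.
Proof.
have -> : pi / 3 = pi / 2 - pi / 6 :> R by field.
by rewrite sinB sin_pihalf cos_pihalf mul1r mul0r subr0 cos_pi6.
Qed.

(** Going to the next vertex turns the sides by a third of a full turn, so the
three arcs are treated as one. *)
Lemma ccw_triangle_rot p q r f : ccw_triangle p q r f ->
  ccw_triangle q r p (f + pi / 3 *+ 2).
Proof.
have s3 : Num.sqrt 3 ^+ 2 = 3 :> R by rewrite sqr_sqrtr.
move=> [-> ->]; rewrite /ccw_triangle /unit_circle_point.
rewrite (_ : f + pi / 3 *+ 2 + pi / 3 = f + pi); last by field.
have cg : cos (pi / 3 *+ 2) = - (1 / 2) :> R by rewrite cos_mulr2n cos_pi3; field.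
have sg : sin (pi / 3 *+ 2) = Num.sqrt 3 / 2 :> R.
  by rewrite sin_mulr2n cos_pi3 sin_pi3; field.
rewrite cosDpi sinDpi; move: (pi / 3 *+ 2) cg sg => g cg sg.
rewrite !cosD !sinD cg sg cos_pi3 sin_pi3 /=.
case: (p) => p1 p2 /=; split; last by congr pair; ring.
by congr pair; field.
Qed.

Lemma ccw_triangle_exists a b c : equilateral a b c ->
  exists f, ccw_triangle a b c f \/ ccw_triangle a c b f.
Proof.
move=> [ab bc ca].
have s3 : Num.sqrt 3 ^+ 2 = 3 :> R by rewrite sqr_sqrtr.
have ab' : (b.1 - a.1) ^+ 2 + (b.2 - a.2) ^+ 2 = 1 by rewrite -ab /sqdist; ring.
have [f [_ _]] := polar_angle 0 ab'; rewrite add0r => f1 f2.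
have bE : b = unit_circle_point a f.
  by rewrite /unit_circle_point -f1 -f2 [LHS]surjective_pairing; congr pair; ring.
pose L := cos f * (c.1 - a.1) + sin f * (c.2 - a.2).
pose H := cos f * (c.2 - a.2) - sin f * (c.1 - a.1).
have cf := cos2Dsin2 f.
have LE : L = 1 / 2.
  transitivity ((sqdist a b + sqdist c a - sqdist b c) / 2); last by rewrite ab bc ca; field.
  by rewrite /L -f1 -f2 /sqdist; field.
have H2 : H ^+ 2 = 3 / 4.
  have : H ^+ 2 + L ^+ 2 = (cos f ^+ 2 + sin f ^+ 2) * sqdist c a.
    by rewrite /H/L/sqdist; ring.
  by rewrite cf ca LE; lra.
have c1 : c.1 = a.1 + (L * cos f - H * sin f).
  transitivity (a.1 + (cos f ^+ 2 + sin f ^+ 2) * (c.1 - a.1)).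
    by rewrite cf; ring.
  by rewrite /L/H; ring.
have c2 : c.2 = a.2 + (L * sin f + H * cos f).
  transitivity (a.2 + (cos f ^+ 2 + sin f ^+ 2) * (c.2 - a.2)).
    by rewrite cf; ring.
  by rewrite /L/H; ring.
have : (H - Num.sqrt 3 / 2) * (H + Num.sqrt 3 / 2) = 0.
  by rewrite -subr_sqr H2 expr_div_n s3; field.
move/eqP; rewrite mulf_eq0 => /orP[|] /eqP HE.
  exists f; left; split => //.
  rewrite /unit_circle_point cosD sinD cos_pi3 sin_pi3 [LHS]surjective_pairing.
  have -> : Num.sqrt 3 / 2 = H by lra.
  by rewrite c1 c2 LE; congr pair; ring.
exists (f - pi / 3); right; split; last by rewrite subrK.
rewrite /unit_circle_point cosB sinB cos_pi3 sin_pi3 [LHS]surjective_pairing.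
have -> : Num.sqrt 3 / 2 = - H by lra.
by rewrite c1 c2 LE; congr pair; ring.
Qed.

(** A point at distance less than [1] from all three vertices is interior; a
point at distance [1] from a vertex can be pushed out of the corresponding
disk. *)
Lemma reuleaux_triangle_boundary a b c : equilateral a b c ->
  boundary (reuleaux_triangle a b c) =
  [set x | reuleaux_triangle a b c x /\
           [\/ sqdist a x = 1, sqdist b x = 1 | sqdist c x = 1]].
Proof.
move=> abc; have bca := equilateral_rot abc; have cab := equilateral_rot bca.
rewrite /boundary -(closure_id _).1; last exact: reuleaux_triangle_closed.
apply/seteqP; split => x [Tx] nx; split => //.
  have := Tx; rewrite reuleaux_triangleE => -[ax bx cx].
  apply: contrapT => nn; apply: nx; apply: reuleaux_triangle_interior;
    rewrite lt_neqAle ?ax ?bx ?cx andbT; apply/eqP => h; apply: nn.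
  - exact: Or31.
  - exact: Or32.
  - exact: Or33.
move=> ix; case: nx => h.
- exact: (not_interior h ix).
- by rewrite reuleaux_triangle_rot in ix; exact: (not_interior h ix).
- by rewrite 2!reuleaux_triangle_rot in ix; exact: (not_interior h ix).
Qed.

(** The arc around [a] runs from [b] to [c], the arc around [b] from [c] to [a]
and the arc around [c] from [a] to [b]; hence the vertices in the order [b],
[c], [a]. *)
Lemma ccw_reuleaux_triangle a b c f : equilateral a b c -> ccw_triangle a b c f ->
  reuleaux_polygon (reuleaux_triangle a b c) [set a; b; c].
Proof.
move=> abc cw; have bca := equilateral_rot abc; have cab := equilateral_rot bca.
have pi0 : 0 < pi :> R := pi_gt0 R.
have cw1 := ccw_triangle_rot cw; have cw2 := ccw_triangle_rot cw1.
have d0 x : sqdist x x = 0 by rewrite /sqdist !subrr expr0n/= addr0.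
have neq x y : sqdist x y = 1 -> x <> y.
  by move=> + xy; rewrite xy d0 => /eqP; rewrite eq_sym oner_eq0.
have [/neq ab /neq bc /neq ca] := abc.
split; first exact: reuleaux_triangle_body.
  by apply: constant_width_breadth => u u1; exact: reuleaux_triangle_breadth.
pose vs (i : 'I_3) := nth a [:: b; c; a] i.
pose cs (i : 'I_3) := nth a [:: a; b; c] i.
pose ss (i : 'I_3) := f + pi / 3 *+ 2 *+ i.
exists 3%N, vs, cs, ss, (fun i => ss i + pi / 3); split => //.
- split.
  + move=> [[|[|[|//]]] i3] [[|[|[|//]]] j3]; rewrite /vs/= => h; apply: val_inj => //=.
    * by case: (ab (esym h)).
    * by case: (bc (esym h)).
    * by case: (ca (esym h)).
  + by move=> i; apply/andP; split; lra.
  + move=> [[|[|[|//]]] i3]; rewrite /vs/cs/ss/=.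
    * by rewrite mulr0n addr0; case: cw => <- <-.
    * by rewrite mulr1n; case: cw1 => <- <-.
    * by rewrite mulr2n addrA; case: cw2 => <- <-.
  + by move=> [[|[|[|//]]] i3]; rewrite /cs/= => h; [apply: ab|apply: bc|apply: ca].
  + rewrite (reuleaux_triangle_boundary abc).
    have arcE p q r g x : ccw_triangle p q r g ->
        unit_arc p g (g + pi / 3) x <-> [/\ sqdist p x = 1, sqdist q x <= 1 & sqdist r x <= 1].
      by move=> [-> ->]; split => /reuleaux_arc.
    have s0 : ss (Ordinal (isT : (0 < 3)%N)) = f by rewrite /ss/= mulr0n addr0.
    have s1 : ss (Ordinal (isT : (1 < 3)%N)) = f + pi / 3 *+ 2 by rewrite /ss/= mulr1n.
    have s2 : ss (Ordinal (isT : (2 < 3)%N)) = f + pi / 3 *+ 2 + pi / 3 *+ 2.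
      by rewrite /ss/= mulr2n addrA.
    apply/seteqP; split => x.
      rewrite reuleaux_triangleE => -[[ax bx cx]] [] h.
      * exists (Ordinal (isT : (0 < 3)%N)) => //; rewrite s0.
        exact/(arcE _ _ _ _ _ cw).
      * exists (Ordinal (isT : (1 < 3)%N)) => //; rewrite s1.
        exact/(arcE _ _ _ _ _ cw1).
      * exists (Ordinal (isT : (2 < 3)%N)) => //; rewrite s2.
        exact/(arcE _ _ _ _ _ cw2).
    rewrite reuleaux_triangleE => -[[[|[|[|//]]] i3] _].
    * rewrite (_ : Ordinal i3 = Ordinal (isT : (0 < 3)%N)); last exact: val_inj.
      rewrite s0 => /(arcE _ _ _ _ _ cw)[h1 h2 h3]; split; last exact: Or31.
      by split => //; rewrite h1.
    * rewrite (_ : Ordinal i3 = Ordinal (isT : (1 < 3)%N)); last exact: val_inj.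
      rewrite s1 => /(arcE _ _ _ _ _ cw1)[h1 h2 h3]; split; last exact: Or32.
      by split => //; rewrite h1.
    * rewrite (_ : Ordinal i3 = Ordinal (isT : (2 < 3)%N)); last exact: val_inj.
      rewrite s2 => /(arcE _ _ _ _ _ cw2)[h1 h2 h3]; split; last exact: Or33.
      by split => //; rewrite h1.
- apply/seteqP; split => x.
    move=> [[]|] ->.
    * by exists (Ordinal (isT : (2 < 3)%N)).
    * by exists (Ordinal (isT : (0 < 3)%N)).
    * by exists (Ordinal (isT : (1 < 3)%N)).
  move=> [[[|[|[|//]]] i3] _ <-]; rewrite /vs/=.
  * by left; right.
  * by right.
  * by left; left.
- move=> [[|[|[|//]]] i3]; rewrite /cs/=.
  * by left; left.
  * by left; right.
  * by right.
Qed.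

(** Exchanging [b] and [c] changes the orientation but neither the triangle nor
its vertex set. *)
Lemma reuleaux_triangle_polygon a b c : equilateral a b c ->
  reuleaux_polygon (reuleaux_triangle a b c) [set a; b; c].
Proof.
move=> abc; have [f [cw|cw]] := ccw_triangle_exists abc.
  exact: ccw_reuleaux_triangle abc cw.
have acb : equilateral a c b.
  by case: abc => ab bc ca; split; rewrite sqdistC.
rewrite (_ : reuleaux_triangle a b c = reuleaux_triangle a c b); last first.
  by apply/seteqP; split => x [].
rewrite (_ : [set a; b; c] = [set a; c; b]); last by rewrite -!setUA (setUC [set b]).
exact: ccw_reuleaux_triangle acb cw.
Qed.

End TriangleArcs.

Theorem theorem4 (R : realType) (a b c : R * R)
    (hab : eucl_dist a b = 1) (hbc : eucl_dist b c = 1)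
    (hca : eucl_dist c a = 1) :
  [/\ reuleaux_polygon (reuleaux_triangle a b c) [set a; b; c],
      forall P V : set (R * R), reuleaux_polygon P V ->
        (area (skeleton [set a; b; c]) <= area (skeleton V))%E &
      forall P V : set (R * R), reuleaux_polygon P V ->
        (area (skeleton V) < (pi / 4)%:E)%E].
Proof.
have ab : sqdist a b = 1 by exact/eucl_dist_eq1.
have bc : sqdist b c = 1 by exact/eucl_dist_eq1.
have ca : sqdist c a = 1 by exact/eucl_dist_eq1.
split.
- by apply: reuleaux_triangle_polygon; split.
- move=> P V [bP wP [n [v [w [s [t [_ n3 aP VE Vw]]]]]]].
  apply: le_trans (area_equilateral ab bc ca) _.
  by apply: (area_skeleton_ge bP wP aP VE Vw); exact: leq_trans n3.
- move=> P V [bP wP [n [v [w [s [t [_ n3 aP VE Vw]]]]]]].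
  by apply: (area_skeleton_lt bP wP aP VE Vw); exact: leq_trans n3.
Qed.
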